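(* Let $K$ be a field of characteristic zero, $r\ge2$, and let $y=F(\underline u,y)=\sum_{\underline i,j}a_{\underline i,j}\underline u^{\underline i}y^j$ be a strongly reduced Henselian equation. Define $\underline\iota_0=(\iota_{0,1},\dots,\iota_{0,r})$ by $$-\iota_{0,k}:=\min\{0,\ i_k\ \mid\ a_{\underline i,j}\ne0,\ \underline i=(i_1,\dots,i_k,\dots,i_r)\},\qquad k=1,\dots,r.$$ Then the coefficients $c_{\underline n}$ of the unique solution $y_0=\sum_{\underline n>_{\mathrm{grlex}}\underline0}c_{\underline n}\underline u^{\underline n}\in K((u_1^{\mathbb Z},\dots,u_r^{\mathbb Z}))^{\mathrm{grlex}}$ are given by $$c_{\underline n}=\sum_{m=1}^{\mu_{\underline n}}\frac1m\sum_{|\underline M|=m,\ \|\underline M\|=m-1,\ g(\underline M)=\underline n}\frac{m!}{\underline M!}\,\underline A^{\underline M},$$ where $\mu_{\underline n}$ is the greatest integer $m$ such that there exists an $\underline M$ with $|\underline M|=m$, $\|\underline M\|=m-1$ and $g(\underline M)=\underline n$ (if there is no such $\underline M$, then the sum is empty and $c_{\underline n}=0$). Moreover, for $\underline n=(n_1,\dots,n_r)$ (for which such an $\underline M$ exists), $\mu_{\underline n}\le\sum_{k=1}^r\lambda_kn_k$ with $$\lambda_k=\begin{cases}\displaystyle\prod_{j=k+1}^{r-1}(1+\iota_{0,j})+\prod_{j=1}^{r-1}(1+\iota_{0,j})&\text{if }k<r-1,\\[2mm] \displaystyle1+\prod_{j=1}^{r-1}(1+\iota_{0,j})&\text{if }k=r-1,\\[2mm]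 \displaystyle\prod_{j=1}^{r-1}(1+\iota_{0,j})&\text{if }k=r.\end{cases}$$
   Context: For $\underline n\in\mathbb Z^r$, $|\underline n|=n_1+\cdots+n_r$. The graded lexicographic order on $\mathbb Z^r$ is: $\underline n<_{\mathrm{grlex}}\underline m$ iff $|\underline n|<|\underline m|$, or $|\underline n|=|\underline m|$ and $\underline n<_{\mathrm{lex}}\underline m$. $K((u_1^{\mathbb Z},\dots,u_r^{\mathbb Z}))^{\mathrm{grlex}}$ is the field of generalized series $\sum_{\underline n\in\mathbb Z^r}c_{\underline n}\underline u^{\underline n}$ with coefficients in $K$ whose support is well-ordered for $\le_{\mathrm{grlex}}$, with valuation $w(s)=\min\mathrm{Supp}(s)$, $w(0)=\infty$. $K((u_1^{\mathbb Z},\dots,u_r^{\mathbb Z}))^{\mathrm{grlex}}_{\mathrm{Mod}}$ is the subring of series whose exponents are all bounded below by some constant for the componentwise order, i.e. $\bigcup_{\underline n\in\mathbb Z^r}\underline u^{\underline n}K[[\underline u]]$. For a polynomial $Q=\sum_ja_jy^j$ over this field, $w(Q)=\min_jw(a_j)$. A strongly reduced Henselian equation is an equation $y=F(\underline u,y)$ with $F\in K((u_1^{\mathbb Z},\dots,u_r^{\mathbb Z}))^{\mathrm{grlex}}_{\mathrm{Mod}}[y]$, $w(F(\underline u,y))>_{\mathrm{grlex}}\underline0$ and $F(\underline u,0)\not\equiv0$. Such an equation admits a unique solution $y_0\in K((u_1^{\mathbb Z},\dots,u_r^{\mathbb Z}))^{\mathrm{grlex}}$ with $w(y_0)>_{\mathrm{grlex}}\underline0$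 (Hensel's lemma). $\underline M=(m_{\underline i,j})$ ranges over families of nonnegative integers with finite support, indexed by the pairs $(\underline i,j)\in\mathbb Z^r\times\mathbb N$ with $a_{\underline i,j}\ne0$, and $|\underline M|=\sum m_{\underline i,j}$, $\|\underline M\|=\sum j\,m_{\underline i,j}$, $g(\underline M)=\sum m_{\underline i,j}\,\underline i\in\mathbb Z^r$, $\underline M!=\prod m_{\underline i,j}!$, $\underline A^{\underline M}=\prod a_{\underline i,j}^{m_{\underline i,j}}$. *)

(* Defs.v *)
From HB Require Import structures.
From mathcomp Require Import all_boot all_order all_algebra.
From mathcomp Require Import finmap.
From mathcomp Require Import boolp classical_sets functions cardinality fsbigop.
Set Implicit Arguments.
Unset Strict Implicit.
Unset Printing Implicit Defensive.
Import Order.TTheory GRing.Theory Num.Theory.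
Local Open Scope classical_set_scope.
Local Open Scope ring_scope.

Notation expo r := {ffun 'I_r -> int}.

Section Grlex.
Variable r : nat.
Implicit Types (n m p : expo r) (A B : set (expo r)).

Definition total_degree n : int := \sum_k n k.

Definition lex_lt n m : bool :=
  [exists k, (n k < m k) && [forall j : 'I_r, (j < k)%N ==> (n j == m j)]].

Definition grlex_lt n m : bool :=
  (total_degree n < total_degree m)
  || ((total_degree n == total_degree m) && lex_lt n m).

Definition grlex_le n m : bool := (n == m) || grlex_lt n m.

Definition is_grlex_min A n := A n /\ forall m, A m -> grlex_le n m.

Definition grlex_well_ordered A :=
  forall B, B `<=` A -> B !=set0 -> exists n, is_grlex_min B n.

Lemma total_degreeD n m :
  total_degree (n + m) = total_degree n + total_degree m.
Proof. by rewrite -big_split; apply: eq_bigr => k _; rewrite ffunE. Qed.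

Lemma lex_ltP n m : reflect
  (exists2 k, n k < m k & forall j : 'I_r, (j < k)%N -> n j = m j) (lex_lt n m).
Proof.
apply: (iffP existsP) => [[k /andP[nmk /forallP H]]|[k nmk H]].
  by exists k => // j jk; apply/eqP; move: (H j); rewrite jk.
exists k; rewrite nmk; apply/forallP => j; apply/implyP => jk.
by rewrite H.
Qed.

Lemma lex_lt_irr n : lex_lt n n = false.
Proof. by apply/lex_ltP => -[k]; rewrite ltxx. Qed.

Lemma lex_lt_trans n m p : lex_lt n m -> lex_lt m p -> lex_lt n p.
Proof.
move=> /lex_ltP[k nmk Hk] /lex_ltP[l mpl Hl]; apply/lex_ltP.
case: (ltngtP k l) => kl.
- exists k => [|j jk]; first by rewrite -Hl.
  by rewrite Hk // Hl // (ltn_trans jk kl).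
- exists l => [|j jl]; first by rewrite Hk.
  by rewrite Hk ?Hl // (ltn_trans jl kl).
- have {}kl : k = l by apply: val_inj.
  rewrite -{l}kl in mpl Hl.
  exists k => [|j jk]; first exact: lt_trans mpl.
  by rewrite Hk ?Hl.
Qed.

Lemma lex_lt_total n m : n != m -> lex_lt n m || lex_lt m n.
Proof.
move=> nm.
have /existsP[k0 k0P] : [exists k, n k != m k].
  rewrite -negb_forall; apply: contra nm => /forallP H.
  by apply/eqP/ffunP => k; apply/eqP.
have [k /= kP kmin] :=
  @arg_minnP _ k0 (fun k => n k != m k) (fun k => nat_of_ord k) k0P.
have H (j : 'I_r) : (j < k)%N -> n j = m j.
  move=> jk; apply/eqP; rewrite -[_ == _]negbK; apply/negP => /kmin.
  by rewrite leqNgt jk.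
case: (ltgtP (n k) (m k)) => [h|h|h].
- by apply/orP; left; apply/lex_ltP; exists k.
- by apply/orP; right; apply/lex_ltP; exists k => // j /H.
- by rewrite h eqxx in kP.
Qed.

Lemma lex_ltD p n m : lex_lt (p + n) (p + m) = lex_lt n m.
Proof.
apply/lex_ltP/lex_ltP => -[k nmk H]; exists k; move: nmk; rewrite ?ffunE ?ltrD2l //.
  by move=> _ j /H; rewrite !ffunE => /addrI.
by move=> _ j /H nmj; rewrite !ffunE nmj.
Qed.

Lemma grlex_lt_irr n : grlex_lt n n = false.
Proof. by rewrite /grlex_lt ltxx lex_lt_irr andbF. Qed.

Lemma grlex_lt_trans n m p : grlex_lt n m -> grlex_lt m p -> grlex_lt n p.
Proof.
rewrite /grlex_lt => /orP[h1|/andP[/eqP e1 h1]] /orP[h2|/andP[/eqP e2 h2]].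
- by rewrite (lt_trans h1 h2).
- by rewrite -e2 h1.
- by rewrite e1 h2.
- by rewrite e1 e2 eqxx (lex_lt_trans h1 h2) orbT.
Qed.

Lemma grlex_lt_total n m : n != m -> grlex_lt n m || grlex_lt m n.
Proof.
move=> nm; rewrite /grlex_lt.
by case: ltgtP => //= _; exact: lex_lt_total.
Qed.

Lemma grlex_ltD p n m : grlex_lt (p + n) (p + m) = grlex_lt n m.
Proof.
by rewrite /grlex_lt !total_degreeD ltrD2l (inj_eq (addrI _)) lex_ltD.
Qed.

Lemma grlex_le_refl n : grlex_le n n.
Proof. by rewrite /grlex_le eqxx. Qed.

Lemma grlex_le_trans n m p : grlex_le n m -> grlex_le m p -> grlex_le n p.
Proof.
move=> /orP[/eqP-> //|h1] /orP[/eqP<-|h2]; rewrite /grlex_le.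
  by rewrite h1 orbT.
by rewrite (grlex_lt_trans h1 h2) orbT.
Qed.

Lemma grlex_le_anti n m : grlex_le n m -> grlex_le m n -> n = m.
Proof.
move=> /orP[/eqP-> //|h1] /orP[/eqP<- //|h2].
by have := grlex_lt_trans h1 h2; rewrite grlex_lt_irr.
Qed.

Lemma grlex_leNgt n m : grlex_le n m = ~~ grlex_lt m n.
Proof.
rewrite /grlex_le; case: (eqVneq n m) => [->|nm]; first by rewrite grlex_lt_irr.
apply/idP/idP => [h|h].
  by apply/negP => h'; have := grlex_lt_trans h h'; rewrite grlex_lt_irr.
by have := grlex_lt_total nm; rewrite (negPf h) orbF.
Qed.

Lemma grlex_ltW n m : grlex_lt n m -> grlex_le n m.
Proof. by rewrite /grlex_le => ->; rewrite orbT. Qed.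

Lemma grlex_leD p n m : grlex_le (p + n) (p + m) = grlex_le n m.
Proof. by rewrite !grlex_leNgt grlex_ltD. Qed.

Lemma grlex_leN n m : grlex_le (- n) (- m) = grlex_le m n.
Proof. by rewrite -(grlex_leD (n + m)) addrK addrAC subrr add0r. Qed.

Lemma grlex_leDD n1 n2 m1 m2 :
  grlex_le n1 m1 -> grlex_le n2 m2 -> grlex_le (n1 + n2) (m1 + m2).
Proof.
move=> h1 h2; apply: (@grlex_le_trans _ (n1 + m2)); first by rewrite grlex_leD.
by rewrite ![_ + m2]addrC grlex_leD.
Qed.

Lemma grlex_well_orderedS A B :
  grlex_well_ordered B -> A `<=` B -> grlex_well_ordered A.
Proof. by move=> wB AB C CA; apply: wB; exact: subset_trans AB. Qed.

Lemma grlex_well_ordered0 : grlex_well_ordered set0.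
Proof. by move=> B B0 [x /B0]. Qed.

Lemma grlex_well_ordered1 n : grlex_well_ordered [set n].
Proof.
move=> B B1 [x Bx]; exists x; split=> // y /B1 ->.
by rewrite (B1 _ Bx) grlex_le_refl.
Qed.

Lemma grlex_well_orderedU A B : grlex_well_ordered A -> grlex_well_ordered B ->
  grlex_well_ordered (A `|` B).
Proof.
move=> wA wB C CAB [x Cx].
have [CA|/set0P CA] := eqVneq (C `&` A) set0.
  apply: wB; last by exists x.
  move=> y Cy; case: (CAB _ Cy) => // Ay.
  by have : set0 y by rewrite -CA.
have [CB|/set0P CB] := eqVneq (C `&` B) set0.
  apply: wA; last by exists x.
  move=> y Cy; case: (CAB _ Cy) => // By.
  by have : set0 y by rewrite -CB.
have [a [[Ca Aa] amin]] := wA _ (@subIsetr _ C A) CA.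
have [b [[Cb Bb] bmin]] := wB _ (@subIsetr _ C B) CB.
case: (boolP (grlex_le a b)) => ab.
  exists a; split=> // y Cy; case: (CAB _ Cy) => [Ay|By]; first exact: amin.
  exact: grlex_le_trans ab (bmin _ _).
rewrite grlex_leNgt negbK in ab.
exists b; split=> // y Cy; case: (CAB _ Cy) => [Ay|By]; last exact: bmin.
exact: grlex_le_trans (grlex_ltW ab) (amin _ _).
Qed.

Lemma grlex_ind A (P : expo r -> Prop) : grlex_well_ordered A ->
  (forall n, A n -> (forall m, A m -> grlex_lt m n -> P m) -> P n) ->
  forall n, A n -> P n.
Proof.
move=> wA step n An; apply: contrapT => nPn.
have [m [[Am nPm] mmin]] :=
  wA (A `&` [set n | ~ P n]) (@subIsetl _ _ _) (ex_intro _ n (conj An nPn)).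
apply/nPm/step => // p Ap pm; apply: contrapT => nPp.
by have := mmin p (conj Ap nPp); rewrite grlex_leNgt pm.
Qed.

Lemma grlex_well_orderedD A B : grlex_well_ordered A -> grlex_well_ordered B ->
  grlex_well_ordered [set n + m | n in A & m in B].
Proof.
move=> wA wB C CAB [c0 Cc0].
pose f n m := [/\ A n, B m, C (n + m) &
  forall m', B m' -> C (n + m') -> grlex_le m m'].
have fex n m : A n -> B m -> C (n + m) -> exists m', f n m'.
  move=> An Bm Cnm.
  have [m' [[Bm' Cm'] m'min]] := wB (B `&` [set m | C (n + m)])
    (@subIsetl _ _ _) (ex_intro _ m (conj Bm Cnm)).
  by exists m'; split=> // p Bp Cp; apply: m'min.
pose G n c := C c /\ exists n' m', [/\ A n', B m', c = n' + m' & grlex_le n n'].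
have key m : B m -> forall n, f n m -> exists c, is_grlex_min (G n) c.
  move: m; apply: (grlex_ind wB) => m Bm IH n [An _ Cnm mmin].
  pose D := [set n' | A n' /\ grlex_lt n n' /\
    exists m', [/\ B m', C (n' + m') & grlex_lt m' m]].
  have [D0|/set0P D0] := eqVneq D set0.
    exists (n + m); split; first by split=> //; exists n, m; rewrite grlex_le_refl.
    move=> c [Cc [n' [m' [An' Bm' ec /orP[/eqP nn'|nn']]]]].
      by rewrite ec -nn' grlex_leD mmin // nn' -ec.
    rewrite ec; apply: grlex_leDD (grlex_ltW nn') _.
    rewrite grlex_leNgt; apply/negP => m'm.
    suff : set0 n' by [].
    by rewrite -D0; split=> //; split=> //; exists m'; rewrite -ec.
  have [n1 [[An1 [nn1 [m' [Bm' Cm' m'm]]]] n1min]] := wA D (fun _ => @proj1 _ _) D0.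
  have [m1 fm1] := fex n1 m' An1 Bm' Cm'.
  have [_ Bm1 _ m1min] := fm1.
  have m1m : grlex_lt m1 m.
    have := m1min _ Bm' Cm'; rewrite /grlex_le => /orP[/eqP-> //|h].
    exact: grlex_lt_trans h m'm.
  have [c [Gc cmin]] := IH m1 Bm1 m1m n1 fm1.
  have main d : G n d -> grlex_le (n + m) d \/ grlex_le c d.
    move=> [Cd [n2 [m2 [An2 Bm2 ed nn2]]]].
    case: (boolP (grlex_le n1 n2)) => n12.
      by right; apply: cmin; split=> //; exists n2, m2.
    rewrite grlex_leNgt negbK in n12; left.
    move: nn2 => /orP[/eqP nn2|nn2].
      by rewrite ed -nn2 grlex_leD mmin // nn2 -ed.
    rewrite ed; apply: grlex_leDD (grlex_ltW nn2) _.
    rewrite grlex_leNgt; apply/negP => m2m.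
    have : grlex_le n1 n2.
      by apply: n1min; split=> //; split=> //; exists m2; rewrite -ed.
    by rewrite grlex_leNgt n12.
  have Gnc : G n c.
    have [Cc [n2 [m2 [An2 Bm2 ed nn2]]]] := Gc.
    split=> //; exists n2, m2; split=> //.
    exact: grlex_le_trans (grlex_ltW nn1) nn2.
  have Gnm : G n (n + m).
    by split=> //; exists n, m; rewrite grlex_le_refl.
  case: (boolP (grlex_le (n + m) c)) => h.
    exists (n + m); split=> // d /main[//|]; exact: grlex_le_trans.
  rewrite grlex_leNgt negbK in h; exists c; split=> // d /main[|//].
  exact: grlex_le_trans (grlex_ltW h).
have [a Aa [b Bb eab]] := CAB _ Cc0.
have [a0 [[Aa0 [b0 [Bb0 Cab0]]] a0min]] := wA
  [set n | A n /\ exists m, B m /\ C (n + m)] (fun _ => @proj1 _ _)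
  (ex_intro _ a (conj Aa (ex_intro _ b (conj Bb (eq_rect_r C Cc0 eab))))).
have [m fm] := fex _ _ Aa0 Bb0 Cab0.
have [_ Bm _ _] := fm.
have [c [[Cc _] cmin]] := key m Bm a0 fm.
exists c; split=> // d Cd; apply: cmin; split=> //.
have [n' An' [m' Bm' ed]] := CAB _ Cd.
exists n', m'; split=> //; apply: a0min; split=> //; exists m'; split=> //.
by rewrite ed.
Qed.

Lemma grlex_finite A : grlex_well_ordered A ->
  grlex_well_ordered [set - n | n in A] -> finite_set A.
Proof.
move=> wA wN; apply: contrapT => infA.
have wmax B : B `<=` A -> B !=set0 ->
    exists n, B n /\ forall m, B m -> grlex_le m n.
  move=> BA [x Bx].
  have [_ [[n Bn <-] nmin]] := wN [set - n | n in B] (@image_subset _ _ _ _ _ BA)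
    (ex_intro _ (- x) (ex_intro2 _ _ x Bx erefl)).
  exists n; split=> // m Bm; rewrite -grlex_leN; apply: nmin.
  by exists m.
pose L n := A `&` [set m | grlex_le m n].
have [a0 [Aa0 a0min]] := wA A (@subset_refl _ _)
  (infinite_setN0 infA).
have finL0 : finite_set (L a0).
  apply: (@sub_finite_set _ _ [set a0]); last exact: finite_set1.
  by move=> m [Am ma0]; apply: grlex_le_anti (a0min _ Am).
have [a [[Aa finLa] amax]] := wmax (A `&` [set n | finite_set (L n)])
  (@subIsetl _ _ _) (ex_intro _ a0 (conj Aa0 finL0)).
have infD : infinite_set (A `\` L a).
  move=> finD; apply: infA; apply: (@sub_finite_set _ _ ((A `\` L a) `|` L a)).
    by move=> x Ax; case: (pselect (L a x)); [right|left].
  by rewrite finite_setU.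
have [b [[Ab nLb] bmin]] := wA _ (@subDsetl _ _ _) (infinite_setN0 infD).
have finLb : finite_set (L b).
  apply: (@sub_finite_set _ _ (L a `|` [set b])).
    move=> x [Ax xb]; case: (pselect (L a x)) => [|nL]; [by left|right].
    by apply: grlex_le_anti xb (bmin _ _).
  by rewrite finite_setU; split=> //; exact: finite_set1.
by apply: nLb; split=> //; apply: amax.
Qed.

Lemma grlex_finite_pairs A B n :
  grlex_well_ordered A -> grlex_well_ordered B ->
  finite_set (A `&` [set i | B (n - i)]).
Proof.
move=> wA wB; apply: grlex_finite; first exact: (grlex_well_orderedS wA).
apply: (grlex_well_orderedS
  (grlex_well_orderedD (@grlex_well_ordered1 (- n)) wB)) => _ [i [_ Bi] <-].
exists (- n) => //.
by exists (n - i) => //; rewrite addKr.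
Qed.

End Grlex.

(* hahn K r is K((u_1^Z, ..., u_r^Z))^grlex; only its commutative ring structure
   is set up. *)
Section Hahn.
Variables (K : fieldType) (r : nat).

Definition supp (s : expo r -> K) : set (expo r) := [set n | s n != 0].

Record hahn := Hahn {
  hcoef :> expo r -> K;
  hahn_wo : grlex_well_ordered (supp hcoef) }.

Arguments hahn_wo : clear implicits.
Implicit Types s t v : hahn.

Lemma hahnP s t : s =1 t -> s = t.
Proof.
case: s t => s ws [t wt] /= /funext st; rewrite -{}st in wt *.
by congr Hahn; exact: Prop_irrelevance.
Qed.

HB.instance Definition _ := gen_eqMixin hahn.
HB.instance Definition _ := gen_choiceMixin hahn.

Fact hahn0_wo : grlex_well_ordered (supp (fun _ => 0)).
Proof.
by apply: (grlex_well_orderedS (@grlex_well_ordered0 r)) => n /eqP.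
Qed.
Arguments hahn0_wo : clear implicits.
Definition hahn0 := Hahn hahn0_wo.

Fact hahnN_wo s : grlex_well_ordered (supp (fun n => - s n)).
Proof.
by apply: (grlex_well_orderedS (hahn_wo s)) => n; rewrite /supp /= oppr_eq0.
Qed.
Arguments hahnN_wo : clear implicits.
Definition hahnN s := Hahn (hahnN_wo s).

Fact hahnD_wo s t : grlex_well_ordered (supp (fun n => s n + t n)).
Proof.
apply: (grlex_well_orderedS (grlex_well_orderedU (hahn_wo s) (hahn_wo t))) => n.
rewrite /supp /=; have [->|] := eqVneq (s n) 0; last by left.
by rewrite add0r; right.
Qed.
Arguments hahnD_wo : clear implicits.
Definition hahnD s t := Hahn (hahnD_wo s t).

Fact hahnDA : associative hahnD.
Proof. by move=> s t v; apply: hahnP => n; exact: addrA. Qed.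
Fact hahnDC : commutative hahnD.
Proof. by move=> s t; apply: hahnP => n; exact: addrC. Qed.
Fact hahn0D : left_id hahn0 hahnD.
Proof. by move=> s; apply: hahnP => n; exact: add0r. Qed.
Fact hahnNl : left_inverse hahn0 hahnN hahnD.
Proof. by move=> s; apply: hahnP => n; exact: addNr. Qed.

HB.instance Definition _ :=
  GRing.isZmodule.Build hahn hahnDA hahnDC hahn0D hahnNl.

Fact hahn1_wo : grlex_well_ordered (supp (fun n => (n == 0)%:R)).
Proof.
apply: (grlex_well_orderedS (@grlex_well_ordered1 r 0)) => n; rewrite /supp /=.
by have [-> //|_] := eqVneq n 0; rewrite mulr0n eqxx.
Qed.
Arguments hahn1_wo : clear implicits.
Definition hahn1 := Hahn hahn1_wo.

(* The sum is finitely supported when the supports of s and t are well-ordered,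
   see cauchy_finite. *)
Definition cauchy (s t : expo r -> K) (n : expo r) : K :=
  \sum_(i \in [set: expo r]) s i * t (n - i).

Lemma supp_cauchy (s t : expo r -> K) :
  supp (cauchy s t) `<=` [set n + m | n in supp s & m in supp t].
Proof.
move=> n; apply: contraPP => H; apply/negP; rewrite negbK /cauchy fsbig1 //.
move=> i _; apply/eqP; rewrite mulf_eq0; apply: contra_notT H.
rewrite negb_or => /andP[si ti]; exists i => //; exists (n - i) => //.
by rewrite addrC subrK.
Qed.

Fact hahnM_wo s t : grlex_well_ordered (supp (cauchy s t)).
Proof.
apply: (grlex_well_orderedS _ (@supp_cauchy s t)).
exact: grlex_well_orderedD (hahn_wo s) (hahn_wo t).
Qed.
Arguments hahnM_wo : clear implicits.
Definition hahnM s t := Hahn (hahnM_wo s t).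

Lemma cauchy_finite s t n :
  finite_set (supp s `&` [set i | supp t (n - i)]).
Proof. exact: grlex_finite_pairs (hahn_wo s) (hahn_wo t). Qed.

Lemma cauchyE s t n (A : set (expo r)) :
  (forall i, s i * t (n - i) != 0 -> A i) ->
  hahnM s t n = \sum_(i \in A) s i * t (n - i).
Proof.
move=> H; symmetry; apply: fsbig_widen => // i [_ nAi] /=.
by apply/eqP; apply: contra_notT nAi => /H.
Qed.

Fact hahnMC : commutative hahnM.
Proof.
move=> s t; apply: hahnP => n /=.
rewrite /cauchy (@reindex_fsbigT _ _ _ _ _ (fun i => n - i)); last first.
  by exists (fun i => n - i) => i; rewrite subKr.
by apply: eq_fsbigr => i _; rewrite subKr mulrC.
Qed.

Fact hahn1M : left_id hahn1 hahnM.
Proof.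
move=> s; apply: hahnP => n; rewrite (@cauchyE _ _ _ [set 0]).
  by rewrite fsbig_set1 /= eqxx mul1r subr0.
by move=> i /=; have [-> //|_] := eqVneq i 0; rewrite mulr0n mul0r eqxx.
Qed.

Fact hahnMDl : left_distributive hahnM hahnD.
Proof.
move=> s t v; apply: hahnP => n.
pose A := (supp s `&` [set i | supp v (n - i)])
  `|` (supp t `&` [set i | supp v (n - i)]).
have finA : finite_set A by rewrite finite_setU; split; apply: cauchy_finite.
have As i : s i * v (n - i) != 0 -> A i.
  by rewrite mulf_eq0 negb_or => /andP[? ?]; left.
have At i : t i * v (n - i) != 0 -> A i.
  by rewrite mulf_eq0 negb_or => /andP[? ?]; right.
rewrite (@cauchyE _ _ _ A) /=; last first.
  move=> i; rewrite mulrDl; have [->|/As //] := eqVneq (s i * v (n - i)) 0.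
  by rewrite add0r => /At.
rewrite -[cauchy s v n]/(hahnM s v n) -[cauchy t v n]/(hahnM t v n).
rewrite (@cauchyE s v _ A) // (@cauchyE t v _ A) // -fsbig_split //.
by apply: eq_fsbigr => i _; rewrite mulrDl.
Qed.

Fact hahnMA : associative hahnM.
Proof.
move=> s t v; apply: hahnP => n.
pose I := supp s `&`
  [set i | [set a + b | a in supp t & b in supp v] (n - i)].
pose J := [set a + b | a in supp s & b in supp t] `&`
  [set k | supp v (n - k)].
have wo := hahn_wo.
have finI : finite_set I.
  by apply: grlex_finite_pairs => //; apply: grlex_well_orderedD.
have finJ : finite_set J.
  by apply: grlex_finite_pairs => //; apply: grlex_well_orderedD.
rewrite (@cauchyE _ _ _ I); last first.
  move=> i; rewrite mulf_eq0 negb_or => /andP[si tvi]; split=> //.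
  exact: supp_cauchy tvi.
rewrite (@cauchyE _ _ _ J); last first.
  move=> i; rewrite mulf_eq0 negb_or => /andP[sti vi]; split=> //.
  exact: supp_cauchy sti.
transitivity (\sum_(i \in I) \sum_(k \in J) s i * t (k - i) * v (n - k)).
  apply: eq_fsbigr => i; rewrite inE => -[si _] /=.
  rewrite /cauchy (@reindex_fsbigT _ _ _ _ _ (fun k => k - i)); last first.
    by exists (fun k => k + i) => k; rewrite (subrK, addrK).
  rewrite mulr_fsumr; symmetry; under eq_fsbigr => k _.
    rewrite -mulrA -[n - k](_ : n - i - (k - i) = _); last first.
      by rewrite opprB addrA subrK.
    over.
  apply: fsbig_widen => // k [_ nJk] /=; apply/eqP; apply: contra_notT nJk.
  rewrite !mulf_eq0 !negb_or opprB addrA subrK => /and3P[_ tk vk]; split=> //.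
  by exists i => //; exists (k - i) => //; rewrite addrC subrK.
rewrite exchange_fsbig //; apply: eq_fsbigr => k; rewrite inE => -[_ vk] /=.
rewrite -mulr_fsuml; congr (_ * _).
apply: fsbig_widen => // i [_ nIi] /=; apply/eqP; apply: contra_notT nIi.
rewrite mulf_eq0 negb_or => /andP[si tk]; split=> //.
by exists (k - i) => //; exists (n - k) => //; rewrite addrC addrA subrK.
Qed.

Fact hahn1_neq0 : hahn1 != 0.
Proof.
apply/eqP => /(congr1 (fun s : hahn => s 0)) /eqP.
by rewrite /= eqxx oner_eq0.
Qed.

HB.instance Definition _ := GRing.Zmodule_isComNzRing.Build hahn
  hahnMA hahnMC hahn1M hahnMDl hahn1_neq0.

End Hahn.
Arguments hahn_wo {K r} h.

(* Values in Z^r together with infinity, which is encoded by None. *)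
Section Valuation.
Variables (K : fieldType) (r : nat).

Definition vlt (a b : option (expo r)) : bool :=
  match a, b with
  | Some n, Some m => grlex_lt n m
  | Some _, None => true
  | None, _ => false
  end.

Definition vmin (a b : option (expo r)) := if vlt b a then b else a.

Definition val_series (s : hahn K r) : option (expo r) :=
  if s == 0 then None else Some (xget 0 (is_grlex_min (supp s))).

Definition val_poly (Q : {poly hahn K r}) : option (expo r) :=
  \big[vmin/None]_(j < size Q) val_series Q`_j.

Lemma val_seriesP (s : hahn K r) : s != 0 ->
  exists2 n, val_series s = Some n & is_grlex_min (supp s) n.
Proof.
move=> s0; rewrite /val_series (negPf s0); eexists; first by [].
have [||n nP] := hahn_wo s (supp s) => //; last exact: (xgetPex _ (ex_intro _ n nP)).
apply/set0P; apply: contraNneq s0 => supp0; apply/eqP/hahnP => n /=.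
apply/eqP; rewrite -[_ == _]negbK; apply/negP => sn.
by have : set0 n by rewrite -supp0.
Qed.

End Valuation.

Section Henselian.
Variables (K : fieldType) (r : nat).
Implicit Types (F : {poly hahn K r}) (n : expo r).

Definition in_Mod (s : hahn K r) :=
  exists b : expo r, forall n, s n != 0 -> forall k, b k <= n k.

Definition strongly_reduced F :=
  [/\ forall j, in_Mod F`_j, vlt (Some 0) (val_poly F) & F.[0] != 0].

Definition is_solution F (y : hahn K r) :=
  y = F.[y] /\ vlt (Some 0) (val_series y).

(* The coefficient a_(i,j), with p = (i, j). *)
Definition acoef F (p : expo r * nat) : K := F`_p.2 p.1.

(* Families of nonnegative integers with finite support; those indexed by the
   (i, j) with a_(i,j) != 0 are the ones extended by 0 elsewhere. *)
Definition family := {fsfun expo r * nat -> nat with 0%N}.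
Implicit Types M : family.

Definition indexed_by F M := forall p, p \in finsupp M -> acoef F p != 0.

Definition fam_size M : nat := (\sum_(p <- finsupp M) M p)%N.
Definition fam_norm M : nat := (\sum_(p <- finsupp M) p.2 * M p)%N.
Definition fam_weight M : expo r := \sum_(p <- finsupp M) p.1 *+ M p.
Definition fam_fact M : nat := (\prod_(p <- finsupp M) (M p)`!)%N.
Definition fam_monom F M : K := \prod_(p <- finsupp M) acoef F p ^+ M p.

(* The second condition is ||M|| = m - 1, with the subtraction in Z. *)
Definition families F n (m : nat) : set family :=
  [set M | [/\ indexed_by F M, fam_size M = m, (fam_norm M).+1 = m
             & fam_weight M = n]].

Definition is_greatest (A : set nat) (m : nat) := A m /\ ubound A m.

Definition levels F n : set nat := [set m | families F n m !=set0].

Definition mu F n : nat := xget 0%N (is_greatest (levels F n)).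

Definition is_least (A : set int) (x : int) := A x /\ lbound A x.

Definition iota_set F (k : 'I_r) : set int :=
  [set x | x = 0 \/ exists i j, acoef F (i, j) != 0 /\ x = i k].

Definition iota0 F (k : 'I_r) : int := - xget 0 (is_least (iota_set F k)).

(* With k ranging over 0, ..., r - 1, the cases k < r - 1, k = r - 1 and k = r
   of the one-based indexing read k.+2 < r, k.+2 = r and k.+1 = r. *)
Definition lambda F (k : 'I_r) : int :=
  let P : int := \prod_(j < r | (j.+1 < r)%N) (1 + iota0 F j) in
  if (k.+2 < r)%N then
    \prod_(j < r | (k < j)%N && (j.+1 < r)%N) (1 + iota0 F j) + P
  else if k.+2 == r then 1 + P
  else P.

Lemma iota0P F k :
  (forall j, in_Mod F`_j) -> is_least (iota_set F k) (- iota0 F k).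
Proof.
move=> /choice[b bP]; rewrite /iota0 opprK.
suff [x xP] : exists x, is_least (iota_set F k) x by exact: (xgetPex _ (ex_intro _ x xP)).
pose B : nat := \sum_(j < size F) `|b j k|%N.
have lbB : lbound (iota_set F k) (- B%:Z).
  move=> x [->|[i [j [aij ->]]]]; first by rewrite oppr_le0.
  have jF : (j < size F)%N.
    rewrite ltnNge; apply: contra aij => /leq_sizeP/(_ j (leqnn j)) Fj.
    by rewrite /acoef /= Fj.
  apply: le_trans (bP _ _ aij k); rewrite lerNl.
  apply: (@le_trans _ _ (`|b j k|%N)%:Z); first by rewrite abszE -normrN ler_norm.
  by rewrite lez_nat /B (bigD1 (Ordinal jF)) //= leq_addr.
pose Q := [pred d : nat | `[< iota_set F k (d%:Z - B%:Z) >]].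
have Qex : exists d, Q d.
  by exists B; apply/asboolP; rewrite subrr; left.
case: (ex_minnP Qex) => d /asboolP Qd dmin.
exists (d%:Z - B%:Z); split=> // x Ax.
have := lbB _ Ax; rewrite -subr_ge0 opprK => xB.
have /dmin : Q (absz (x + B%:Z)).
  by apply/asboolP; rewrite gez0_abs // addrK.
by rewrite lerBlDr -lez_nat gez0_abs.
Qed.

End Henselian.

(* Main.v *)
(* The candidate solution is y0 = sum_(m >= 1) (1/m) [y^(m-1)] F^m, that is,
   Lagrange inversion for Y = t F(Y) evaluated at t = 1; the multinomial theorem
   turns [y^(m-1)] F^m into the sum over the families M.

   Evaluation at t = 1 makes sense thanks to the linear functionals
   L_0(n) = |n| and L_k(n) = (1 + iota_(0,k)) L_(k-1)(n) + n_k.  On exponents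
   n > 0 with n_k >= - iota_(0,k) they are all nonnegative, and L_(r-1) is at
   least 1.  As L_(r-1)(n) = sum_k lambda_k n_k, this gives the bound on mu_n and
   makes the series converge for the filtration by L_(r-1).  Moreover the cone
   where all L_k are nonnegative is well-ordered, since grlex is the
   lexicographic order of (L_0, ..., L_(r-1)); hence y0 has well-ordered support
   without any appeal to Neumann's lemma. *)
From HB Require Import structures.
Require Import Defs.
From mathcomp Require Import all_boot all_order all_algebra.
From mathcomp Require Import finmap.
From mathcomp Require Import boolp classical_sets functions cardinality fsbigop.
From mathcomp Require Import zify ring.
Import Order.TTheory GRing.Theory Num.Theory.
Local Open Scope classical_set_scope.
Local Open Scope ring_scope.
Set Implicit Arguments.
Unset Strict Implicit.
Unset Printing Implicit Defensive.

(** * Cauchy products of sequences *)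

Section Convolution.
Variable A : comNzRingType.
Implicit Types f g h : nat -> A.

Definition conv f g (m : nat) : A := \sum_(a < m.+1) f a * g (m - a)%N.

Lemma eq_conv f f' g g' m :
  (forall i, (i <= m)%N -> f i = f' i) -> (forall i, (i <= m)%N -> g i = g' i) ->
  conv f g m = conv f' g' m.
Proof.
move=> ff gg; apply: eq_bigr => a _.
by rewrite ff ?gg // ?leq_subr // -ltnS.
Qed.

(** At an index below [N] truncation loses nothing, so the laws of [conv] are inherited from
    polynomial multiplication. *)
Lemma conv_coef f g m (N : nat) : (m < N)%N ->
  conv f g m = (\poly_(i < N) f i * \poly_(i < N) g i)`_m.
Proof.
move=> mN; rewrite coefM; apply: eq_bigr => a _.
rewrite !coef_poly (leq_ltn_trans (leq_subr _ _) mN).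
by rewrite (leq_trans (ltn_ord a)).
Qed.

Lemma convC f g m : conv f g m = conv g f m.
Proof. by rewrite !(@conv_coef _ _ m m.+1) // mulrC. Qed.

Lemma convA f g h m : conv f (conv g h) m = conv (conv f g) h m.
Proof.
pose P f := \poly_(i < m.+1) f i : {poly A}.
have PE f' g' i : (i <= m)%N -> conv f' g' i = (P f' * P g')`_i.
  by move=> im; apply: conv_coef.
transitivity ((P f * (P g * P h))`_m); last first.
  rewrite mulrA coefM; apply: eq_bigr => a _; rewrite PE; last by rewrite -ltnS.
  by rewrite [(P h)`__]coef_poly ltnS leq_subr.
rewrite coefM; apply: eq_bigr => a _; rewrite PE ?leq_subr //.
by rewrite [(P f)`__]coef_poly ltn_ord.
Qed.

End Convolution.

(** * Lagrange inversion *)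

(* Formally, with Y(t) the solution of [Y = 'X + t F(Y)], [lag m H] is the
   coefficient of [t^m] in [H(Y)] and [lagD m G] the one in [G(Y) * dY/d'X];
   [v m] stands for the inverse of [m.+1]. *)
Section Lagrange.
Variables (R : comNzRingType) (v : nat -> R) (F : {poly R}).
Hypothesis vP : forall m, m.+1%:R * v m = 1.
Implicit Types G H : {poly R}.

Definition lag (m : nat) H : {poly R} :=
  if m is m'.+1 then v m' *: (F ^+ m'.+1 * H^`())^`N(m') else H.

Definition lagD (m : nat) G : {poly R} := (F ^+ m * G)^`N(m).

Lemma lag_is_linear m : linear (lag m).
Proof.
case: m => [|m] c G H //=.
by rewrite derivD derivZ mulrDr -scalerAr linearP scalerDr !scalerA mulrC.
Qed.
HB.instance Definition _ m :=
  GRing.isLinear.Build R {poly R} {poly R} *:%R (lag m) (lag_is_linear m).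

Lemma lagD_is_linear m : linear (lagD m).
Proof. by move=> c G H; rewrite /lagD mulrDr -scalerAr linearP. Qed.
HB.instance Definition _ m :=
  GRing.isLinear.Build R {poly R} {poly R} *:%R (lagD m) (lagD_is_linear m).

Lemma mulrSn_inj m : injective (fun H => H *+ m.+1).
Proof.
move=> G H /= /(congr1 (fun P => v m *: P)).
by rewrite -!scaler_nat !scalerA mulrC vP !scale1r.
Qed.

Lemma deriv_nderivn m G : (G^`N(m))^`() = G^`N(m.+1) *+ m.+1.
Proof.
apply/polyP => i; rewrite coef_deriv !coefMn !coef_nderivn -!mulrnA addnS addSn.
congr (_ *+ _); rewrite [LHS]mulnC [RHS]mulnC mul_bin_left.
by congr (_ * _)%N; lia.
Qed.

(** Coefficient form of the chain rule for H(Y), differentiated in ['X]. *)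
Lemma deriv_lag m H : (lag m H)^`() = lagD m H^`().
Proof.
case: m => [|m] /=; first by rewrite /lagD mul1r nderivn0.
by rewrite derivZ deriv_nderivn -scaler_nat scalerA mulrC vP scale1r.
Qed.

(** Coefficient form of the chain rule in t, using dY/dt = F(Y) dY/d'X. *)
Lemma lagS m H : lag m.+1 H *+ m.+1 = lagD m (F * H^`()).
Proof. by rewrite /= -scaler_nat scalerA vP scale1r /lagD exprSr mulrA. Qed.

Lemma lag1 m : lag m 1 = (m == 0)%:R.
Proof. by case: m => //= m; rewrite derivC mulr0 linear0 scaler0. Qed.

Lemma conv_sumr (I : Type) (s : seq I) (f : nat -> {poly R})
    (g : I -> nat -> {poly R}) m :
  conv f (fun i => \sum_(j <- s) g j i) m = \sum_(j <- s) conv f (g j) m.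
Proof.
rewrite /conv exchange_big; apply: eq_bigr => a _; exact: mulr_sumr.
Qed.


(** Multiplicativity of the substitution of Y up to order [m] in t: the induction hypothesis in the
    proof of [lagM]. *)
Definition lag_mult m := forall i G H,
  (i <= m)%N -> lag i (G * H) = conv (lag^~ G) (lag^~ H) i.

(** Induction on [j]: differentiate Y^(j+2) = Y Y^(j+1) in ['X]. The product rule yields 1 and j+1
    copies of Y^(j+1) dY/d'X, and the factor j+2 is cancelled. *)
Lemma lagDXn m : lag_mult m ->
  forall j i, (i <= m)%N -> lagD i 'X^j = conv (lag^~ ('X^j)) (lagD^~ 1) i.
Proof.
move=> P; elim=> [|j IH] i im.
  rewrite expr0 /conv big_ord_recl big1 => [|a _]; last by rewrite lag1 mul0r.
  by rewrite lag1 mul1r subn0 addr0.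
apply: (@mulrSn_inj j.+1); rewrite -[LHS](raddfMn (lagD i)) /=.
rewrite -(derivXn R j.+2).
rewrite -deriv_lag exprS P // /conv raddf_sum /=.
transitivity (conv (lagD^~ 1) (lag^~ ('X^(j.+1))) i
    + conv (lag^~ 'X) (lagD^~ ('X^j)) i *+ j.+1).
  rewrite /conv -sumrMnl -big_split; apply: eq_bigr => a _ /=.
  by rewrite derivM !deriv_lag derivX derivXn /= raddfMn mulrnAr.
rewrite convC [RHS]mulrS; congr (_ + _ *+ _).
transitivity (conv (lag^~ 'X) (conv (lag^~ 'X^j) (lagD^~ 1)) i).
  by apply: eq_conv => // k ki; apply: IH; exact: leq_trans ki im.
rewrite convA; apply: (@eq_conv _ _ (lag^~ 'X^(j.+1)) _ (lagD^~ 1)) => // k ki.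
by rewrite exprS P //; exact: leq_trans ki im.
Qed.

Lemma lagDM1 m : lag_mult m ->
  forall i G, (i <= m)%N -> lagD i G = conv (lag^~ G) (lagD^~ 1) i.
Proof.
move=> P i G im; rewrite -[G]coefK poly_def linear_sum /=.
rewrite convC.
transitivity (conv (lagD^~ 1) (fun k => \sum_(j < size G) lag k (G`_j *: 'X^j)) i).
  rewrite conv_sumr; apply: eq_bigr => j _.
  rewrite linearZ /= (lagDXn P) // convC /conv scaler_sumr.
  by apply: eq_bigr => a _; rewrite linearZ scalerAr.
by apply: eq_conv => // k _; rewrite linear_sum.
Qed.

Lemma lagDM m : lag_mult m ->
  forall G H, lagD m (G * H) = conv (lag^~ G) (lagD^~ H) m.
Proof.
move=> P G H; rewrite (lagDM1 P) //.
transitivity (conv (lag^~ G) (conv (lag^~ H) (lagD^~ 1)) m).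
  by rewrite convA; apply: eq_conv => // k km; exact: P.
by apply: eq_conv => // k km; rewrite (lagDM1 P).
Qed.

(** By induction on the order. Differentiation in t ([lagS]) brings order m+1 down to order m, where
    the product rule and the induction hypothesis apply; cancelling m+1 integrates back. *)
Lemma lagM m G H : lag m (G * H) = conv (lag^~ G) (lag^~ H) m.
Proof.
elim/ltn_ind: m G H => -[|m] IH G H; first by rewrite /conv big_ord1.
have P : lag_mult m by move=> i *; apply: IH.
apply: (@mulrSn_inj m); rewrite lagS derivM mulrDr raddfD /=.
have -> : F * (G^`() * H) = H * (F * G^`()) by ring.
have -> : F * (G * H^`()) = G * (F * H^`()) by ring.
rewrite !(lagDM P) convC /conv.
(* Each term is weighted by its order in [G], so the added term of index 0 vanishes. The next sum is
   weighted by the order in [H]; the two weights add up to m+1. *)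
have -> : \sum_(a < m.+1) lagD a (F * G^`()) * lag (m - a) H =
    \sum_(a < m.+2) lag a G * lag (m.+1 - a) H *+ a.
  rewrite [RHS]big_ord_recl mulr0n add0r; apply: eq_bigr => a _.
  by rewrite lift0 subSS -lagS mulrnAl.
have -> : \sum_(a < m.+1) lag a G * lagD (m - a) (F * H^`()) =
    \sum_(a < m.+2) lag a G * lag (m.+1 - a) H *+ (m.+1 - a).
  rewrite [RHS]big_ord_recr /= subnn mulr0n addr0; apply: eq_bigr => a _.
  by rewrite -lagS -subSn -1?ltnS // mulrnAr.
rewrite -big_split -sumrMnl; apply: eq_bigr => a _ /=.
by rewrite -mulrnDr subnKC // -ltnS.
Qed.

(** Putting ['X] at 0 specializes the equation to Y = t F(Y). *)
Definition lag0 m H : R := (lag m H).[0].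

Lemma lag0_sum (I : Type) (s : seq I) (c : I -> R) (G : I -> {poly R}) m :
  lag0 m (\sum_(j <- s) c j *: G j) = \sum_(j <- s) c j * lag0 m (G j).
Proof.
rewrite /lag0 linear_sum horner_sum; apply: eq_bigr => j _.
by rewrite linearZ hornerZ.
Qed.

Lemma lag0M m G H : lag0 m (G * H) = conv (lag0^~ G) (lag0^~ H) m.
Proof. by rewrite /lag0 lagM horner_sum; apply: eq_bigr => a _; rewrite hornerM. Qed.

Lemma lag0S m H : lag0 m.+1 H = v m * (F ^+ m.+1 * H^`())`_m.
Proof. by rewrite /lag0 hornerZ horner_coef0 coef_nderivn addn0 binn. Qed.

Lemma lag0X m : lag0 m.+1 'X = v m * (F ^+ m.+1)`_m.
Proof. by rewrite lag0S derivX mulr1. Qed.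

(** Coefficient form of Y = t F(Y). For positive [m] it equates two expressions of the coefficient
    of degree m-1 in the derivative of F^(m+1). *)
Lemma lag0_fixpoint m : lag0 m F = lag0 m.+1 'X.
Proof.
rewrite lag0X; case: m => [|m].
  by rewrite /lag0 horner_coef0 expr1 -[LHS]mul1r -(vP 0) mul1r.
have := congr1 (fun P : {poly R} => P`_m) (deriv_exp F m.+2).
rewrite lag0S [F^`() * _]mulrC coef_deriv coefMn /= => XY.
rewrite -[LHS]mulr_natl -[RHS]mulr_natl in XY.
rewrite -[LHS]mul1r -[X in X * _ = _](vP m.+1).
rewrite -[RHS]mul1r -[X in _ = X * _](vP m).
move: _`_m _`_m.+1 m.+1%:R m.+2%:R (v m) (v m.+1) XY => X Y a b v0 v1 XY.
transitivity (v0 * v1 * (b * X)); first by ring.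
by rewrite -XY; ring.
Qed.

End Lagrange.

(** * Control of supports, and uniqueness of the solution *)

Section HahnSupport.
Variables (K : fieldType) (r : nat).
Implicit Types (s t : hahn K r) (p q : {poly hahn K r}) (n : expo r).
Implicit Types (A B C : set (expo r)).

Lemma hcoef_sum (I : Type) (l : seq I) (P : pred I) (f : I -> hahn K r) n :
  (\sum_(i <- l | P i) f i) n = \sum_(i <- l | P i) f i n.
Proof. exact: (big_morph (fun s : hahn K r => s n)). Qed.

Lemma hcoefMn s m n : (s *+ m) n = s n *+ m.
Proof. by elim: m => [//|m IH]; rewrite !mulrS -IH. Qed.

Lemma hahnC_wo (a : K) :
  grlex_well_ordered (supp (fun n : expo r => if n == 0 then a else 0)).
Proof.
apply: (grlex_well_orderedS (@grlex_well_ordered1 r 0)) => n.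
by rewrite /supp /=; have [->|_ /eqP] := eqVneq n 0.
Qed.
Definition hahnC (a : K) := Hahn (@hahnC_wo a).

Lemma hcoefCM a s n : (hahnC a * s) n = a * s n.
Proof.
rewrite [LHS](@cauchyE _ _ _ _ _ [set 0]); first by rewrite fsbig_set1 /= eqxx subr0.
by move=> i /=; have [//|_] := eqVneq i 0; rewrite mul0r eqxx.
Qed.

Lemma supp_hahnC A a : A 0 -> supp (hahnC a) `<=` A.
Proof. by move=> A0 n; rewrite /supp /=; have [->|_ /eqP] := eqVneq n 0. Qed.

Lemma supp1 A : A 0 -> supp (1 : hahn K r) `<=` A.
Proof.
by move=> A0 n; rewrite /supp /=; have [->//|_] := eqVneq n 0; rewrite mulr0n eqxx.
Qed.

Lemma supp0 A : supp (0 : hahn K r) `<=` A.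
Proof. by move=> n /eqP. Qed.

Lemma suppD A s t : supp s `<=` A -> supp t `<=` A -> supp (s + t) `<=` A.
Proof.
move=> sA tA n; rewrite /supp /=; have [->|sn _] := eqVneq (s n) 0; last exact: sA.
by rewrite add0r; exact: tA.
Qed.

Lemma suppN A s : supp s `<=` A -> supp (- s) `<=` A.
Proof. by move=> sA n; rewrite /supp /= oppr_eq0; exact: sA. Qed.

Lemma suppB A s t : supp s `<=` A -> supp t `<=` A -> supp (s - t) `<=` A.
Proof. by move=> sA tA; apply: suppD => //; exact: suppN. Qed.

Lemma supp_sum A (I : Type) (l : seq I) (P : pred I) (f : I -> hahn K r) :
  (forall i, P i -> supp (f i) `<=` A) -> supp (\sum_(i <- l | P i) f i) `<=` A.
Proof.
by move=> fA; elim/big_rec: _ => [|i s Pi sA]; [exact: supp0 | apply: suppD; auto].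
Qed.

(** With three sets this covers closure under addition as well as the additivity of a filtration. *)
Definition adds A B C := forall n m, A n -> B m -> C (n + m).

Lemma suppM A B C s t : adds A B C ->
  supp s `<=` A -> supp t `<=` B -> supp (s * t) `<=` C.
Proof. by move=> ABC sA tB n /supp_cauchy[a /sA Aa [b /tB Bb <-]]; exact: ABC. Qed.

Definition supp_poly p A := forall i, supp p`_i `<=` A.

Lemma supp_polyM A B C p q : adds A B C ->
  supp_poly p A -> supp_poly q B -> supp_poly (p * q) C.
Proof.
move=> ABC pA qB i; rewrite coefM; apply: supp_sum => j _; exact: suppM (pA _) (qB _).
Qed.

Lemma supp_poly1 A : A 0 -> supp_poly 1 A.
Proof. by move=> A0 i; rewrite coef1; case: eqP => _; [exact: supp1|exact: supp0]. Qed.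

(** Only positive powers occur, which suits sets that omit 0, such as [pcone] below. *)
Lemma supp_polyXS A p m : adds A A A -> supp_poly p A -> supp_poly (p ^+ m.+1) A.
Proof.
move=> AAA pA; elim: m => [//|m IH]; rewrite exprS; exact: supp_polyM pA IH.
Qed.

Lemma supp_polyX A p m : A 0 -> adds A A A -> supp_poly p A -> supp_poly (p ^+ m) A.
Proof. by case: m => [*|m _]; [exact: supp_poly1|exact: supp_polyXS]. Qed.

Lemma suppX A s m : A 0 -> adds A A A -> supp s `<=` A -> supp (s ^+ m) `<=` A.
Proof.
move=> A0 AAA sA; elim: m => [|m IH]; first exact: supp1.
rewrite exprS; exact: suppM sA IH.
Qed.

Lemma supp_horner A B p s : B 0 -> adds B B B -> adds A B A ->
  supp_poly p A -> supp s `<=` B -> supp p.[s] `<=` A.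
Proof.
move=> B0 BB AB pA sB; rewrite horner_coef; apply: supp_sum => i _.
apply: suppM AB (pA i) _; exact: suppX.
Qed.

(** Factors [s - t] out of every [s ^+ i - t ^+ i]. The support of the cofactor measures how [p]
    moves differences: positive exponents serve uniqueness, nonnegative gauge serves the passage
    from partial sums to the limit. *)
Lemma horner_diff A B p s t : B 0 -> adds B B B -> adds A B A ->
    supp_poly p A -> supp s `<=` B -> supp t `<=` B ->
  exists2 g, p.[s] - p.[t] = (s - t) * g & supp g `<=` A.
Proof.
move=> B0 BB AB pA sB tB.
exists (\sum_(i < size p) p`_i * \sum_(j < i) s ^+ (i.-1 - j) * t ^+ j).
  rewrite !horner_coef -sumrB mulr_sumr; apply: eq_bigr => i _.
  rewrite -mulrBr mulrCA; congr (_ * _).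
  case: (nat_of_ord i) => [|k]; first by rewrite !expr0 big_ord0 subrr mulr0.
  by rewrite subrXX; congr (_ * _); apply: eq_bigr => j _; rewrite subSS.
apply: supp_sum => i _; apply: suppM AB (pA i) _; apply: supp_sum => j _.
by apply: (suppM BB); exact: suppX.
Qed.

Lemma hahn_min s : s != 0 -> exists n, is_grlex_min (supp s) n.
Proof. by case/val_seriesP => n; exists n. Qed.

Definition grlex_pos : set (expo r) := [set n | grlex_lt 0 n].
Definition grlex_nneg : set (expo r) := [set n | grlex_le 0 n].

Lemma grlex_nneg0 : grlex_nneg 0.
Proof. exact: grlex_le_refl. Qed.

Lemma grlex_nnegD : adds grlex_nneg grlex_nneg grlex_nneg.
Proof. by move=> n m n0 m0; rewrite /grlex_nneg /= -[X in grlex_le X]addr0; exact: grlex_leDD. Qed.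

Lemma grlex_posD : adds grlex_pos grlex_nneg grlex_pos.
Proof.
move=> n m; rewrite /grlex_nneg /grlex_pos /grlex_le /= => n0 /orP[/eqP<-|m0].
  by rewrite addr0.
by apply: grlex_lt_trans n0 _; rewrite -[X in grlex_lt X]addr0 grlex_ltD.
Qed.

Lemma grlex_pos_nneg : grlex_pos `<=` grlex_nneg.
Proof. by move=> n; exact: grlex_ltW. Qed.

Lemma val_series_gt0 s : vlt (Some 0) (val_series s) <-> supp s `<=` grlex_pos.
Proof.
split=> [|sA]; last first.
  have [->|/val_seriesP[n -> [/sA]] //] := eqVneq s 0; by rewrite /val_series eqxx.
have [->|/val_seriesP[n -> [_ nmin]] /= n0 m /nmin] := eqVneq s 0.
  by move=> _; exact: supp0.
by rewrite /grlex_le => /orP[/eqP<-//|]; exact: grlex_lt_trans.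
Qed.

Lemma val_poly_gt0 p : vlt (Some 0) (val_poly p) -> supp_poly p grlex_pos.
Proof.
move=> p0 i; apply/val_series_gt0.
have [ip|/leq_sizeP/(_ i (leqnn _)) ->] := ltnP i (size p); last first.
  by rewrite /val_series eqxx.
pose P (a : option (expo r)) := vlt (Some 0) a.
have PD a b : P (vmin a b) -> P a /\ P b.
  rewrite /vmin /P; case: a b => [a|] [b|] //=.
  case: ifP => [ba b0|/negbT]; first by split=> //; exact: grlex_lt_trans ba.
  rewrite -grlex_leNgt /grlex_le => /orP[/eqP<-//|ab] a0.
  by split=> //; exact: grlex_lt_trans ab.
move: p0; rewrite /val_poly -/(P _).
have : Ordinal ip \in index_enum 'I_(size p) by rewrite mem_index_enum.
rewrite -[val_series _]/((fun j : 'I_(size p) => val_series p`_j) (Ordinal ip)).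
elim: (index_enum _) (Ordinal ip) => [//|j l IH] j0.
rewrite inE big_cons => /orP[/eqP-> /PD[]//|/IH{}IH /PD[_ /IH]//].
Qed.

(* If [y - z = (y - z) * g] with [g] of positive valuation, then the least
   exponent of [y - z] would be greater than itself. *)
Lemma solution_unique p s t : supp_poly p grlex_pos ->
  is_solution p s -> is_solution p t -> s = t.
Proof.
move=> pA [ps /val_series_gt0 s0] [pt /val_series_gt0 t0].
have [g e g0] := horner_diff grlex_nneg0 grlex_nnegD grlex_posD pA
  (subset_trans s0 grlex_pos_nneg) (subset_trans t0 grlex_pos_nneg).
rewrite -ps -pt in e.
have [/eqP|/hahn_min[n [dn nmin]]] := eqVneq (s - t) 0; first by rewrite subr_eq0 => /eqP.
move: (dn); rewrite e => /supp_cauchy[a /nmin na [b /g0 b0 en]].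
have : grlex_lt a n by rewrite -en -[X in grlex_lt X]addr0 grlex_ltD.
by rewrite -[grlex_lt a n]negbK -grlex_leNgt na.
Qed.

End HahnSupport.

(** * The linear functionals L_k, their cone, and the sum with [lambda] *)

Section Gauge.
Variables (s : nat) (iota : 'I_s.+1 -> int).
Implicit Types (n m : expo s.+1) (k : nat).

(* [gauge 0, ..., gauge s] are related to the degree and the first [s]
   coordinates by a unitriangular matrix with nonnegative entries below the
   diagonal, so comparing the gauges lexicographically is grlex. *)
Fixpoint gauge k n : int :=
  if k is k'.+1 then (1 + iota (inord k')) * gauge k' n + n (inord k')
  else total_degree n.

Lemma gaugeD k n m : gauge k (n + m) = gauge k n + gauge k m.
Proof. by elim: k => [|k IH] /=; rewrite ?total_degreeD // IH ffunE; ring. Qed.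

Lemma gauge0 k : gauge k 0 = 0.
Proof. by apply: (@addrI _ (gauge k 0)); rewrite -gaugeD !addr0. Qed.

Lemma gaugeMn k n a : gauge k (n *+ a) = gauge k n *+ a.
Proof. by elim: a => [|a IH]; rewrite ?gauge0 // !mulrS gaugeD IH. Qed.

Lemma gauge_sum k (I : Type) (l : seq I) (f : I -> expo s.+1) :
  gauge k (\sum_(i <- l) f i) = \sum_(i <- l) gauge k (f i).
Proof. exact: (big_morph (gauge k) (gaugeD k) (gauge0 k)). Qed.

Lemma expo_eq n m : total_degree n = total_degree m ->
  (forall k, (k < s)%N -> n (inord k) = m (inord k)) -> n = m.
Proof.
move=> dnm nm.
have H (i : 'I_s) : n (widen_ord (leqnSn s) i) = m (widen_ord (leqnSn s) i).
  have -> : widen_ord (leqnSn s) i = inord i.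
    by apply: val_inj; rewrite /= inordK // ltnW // ltnS.
  exact: nm.
apply/ffunP => i; case: (unliftP ord_max i) => [j|] ->.
  have -> : lift ord_max j = widen_ord (leqnSn s) j by apply: val_inj; exact: lift_max.
  exact: H.
move: dnm; rewrite /total_degree !big_ord_recr /=.
by rewrite (eq_bigr _ (fun i _ => H i)) => /addrI.
Qed.

Lemma gauge_eq n m k : (forall j, (j <= k)%N -> gauge j n = gauge j m) ->
  total_degree n = total_degree m /\
  forall j, (j < k)%N -> n (inord j) = m (inord j).
Proof.
move=> H; split=> [|j jk]; first exact: (H 0%N).
by have := H j.+1 jk; rewrite /= H ?(ltnW jk) // => /addrI.
Qed.

(** At the first gauge that differs, the difference is that of the degrees if [k] is 0, and
    otherwise that of the coordinate which [gauge k] adds; everything grlex reads earlier agrees by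
    [gauge_eq]. *)
Lemma gauge_lt n m k : (k <= s)%N -> (forall j, (j < k)%N -> gauge j n = gauge j m) ->
  gauge k n < gauge k m -> grlex_lt n m.
Proof.
case: k => [|k] ks H /= nm; first by rewrite /grlex_lt nm.
have [dnm {}H'] := gauge_eq H.
apply/orP; right; rewrite dnm eqxx /=; apply/lex_ltP; exists (inord k).
  by move: nm; rewrite (H k (leqnn _)) ltrD2l.
move=> j; rewrite inordK ?ltnS ?(ltnW ks) // => jk.
by rewrite -(inord_val j) H'.
Qed.

(** Minimizes the gauges one after the other, each being a nonnegative integer. An element tied with
    the minimizer on all of them equals it by [expo_eq]. *)
Lemma gauge_wo : grlex_well_ordered [set n | forall k, (k <= s)%N -> 0 <= gauge k n].
Proof.
move=> B Bpos [n0 Bn0].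
have H k : (k <= s.+1)%N -> exists2 n, B n & forall m, B m ->
    (forall j, (j < k)%N -> gauge j n = gauge j m) \/
    exists j, [/\ (j < k)%N, gauge j n < gauge j m &
                  forall i, (i < j)%N -> gauge i n = gauge i m].
  elim: k => [_|k IH ks]; first by exists n0 => // m Bm; left.
  have [n Bn nmin] := IH (ltnW ks).
  (* The values of the next gauge on the elements still tied with [n]. *)
  pose Q := [pred d : nat | `[< exists n', [/\ B n', gauge k n' = d &
     forall j, (j < k)%N -> gauge j n = gauge j n'] >]].
  have BQ m : B m -> (forall j, (j < k)%N -> gauge j n = gauge j m) ->
      Q `|gauge k m|%N.
    by move=> Bm nm; apply/asboolP; exists m; rewrite gez0_abs ?Bpos.
  have exQ : exists d, Q d by exists `|gauge k n|%N; exact: BQ.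
  have [d /asboolP[n' [Bn' n'd nn']] dmin] := ex_minnP exQ.
  exists n' => // m Bm; case: (nmin m Bm) => [nm|[j [jk jlt jeq]]]; last first.
    right; exists j; rewrite -nn' //; split=> //; first exact: ltnW.
    by move=> i ij; rewrite -nn' ?jeq // (ltn_trans ij).
  have : gauge k n' <= gauge k m.
    have := dmin _ (BQ m Bm nm); rewrite n'd -lez_nat gez0_abs //.
    exact: Bpos.
  rewrite le_eqVlt => /orP[/eqP e|lt].
    left=> j; rewrite ltnS leq_eqVlt => /orP[/eqP->//|jk].
    by rewrite -nn' // nm.
  by right; exists k; split=> // i ik; rewrite -nn' // nm.
have [n Bn nmin] := H s.+1 (leqnn _).
exists n; split=> // m /nmin[nm|[j [js lt nm]]]; last first.
  by apply: grlex_ltW; exact: gauge_lt lt.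
have [dnm /expo_eq ->] := gauge_eq nm; rewrite ?grlex_le_refl //.
Qed.

Hypothesis iota_ge0 : forall j, 0 <= iota j.

(** Once a gauge is at least 1, so is the next: the factor [1 + iota] outweighs a coordinate at
    least [- iota]. While all gauges vanish, the next coordinate is the first datum of [n] that can
    be nonzero, hence is nonnegative as [n] is positive. *)
Lemma gauge_ge1_or n k : grlex_lt 0 n -> (forall j, - iota j <= n j) -> (k <= s)%N ->
  1 <= gauge k n \/ (forall j, (j <= k)%N -> gauge j n = 0).
Proof.
move=> n0 nb; elim: k => [_|k IH ks].
  have : 0 <= total_degree n.
    move: n0; rewrite /grlex_lt -[total_degree 0]/(gauge 0 0) gauge0.
    by case/orP => [/ltW//|/andP[/eqP<-]].
  rewrite le_eqVlt => /orP[/eqP e|lt]; first by right=> -[].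
  by left; rewrite /=; lia.
have := iota_ge0 (inord k); have := nb (inord k).
case: (IH (ltnW ks)) => [g1|g0] /=.
  by left; nia.
rewrite g0 // mulr0 add0r => nk ik.
have nk0 : 0 <= n (inord k).
  rewrite leNgt; apply/negP => nk0.
  suff : grlex_lt n 0 by move=> h; have := grlex_lt_trans h n0; rewrite grlex_lt_irr.
  apply: (@gauge_lt n 0 k.+1) => // [j jk|]; rewrite gauge0; first exact: g0.
  by rewrite /= g0 // mulr0 add0r.
move: nk0; rewrite le_eqVlt => /orP[/eqP e|lt]; last by left; lia.
right=> j; rewrite leq_eqVlt => /orP[/eqP->/=|jk]; last by rewrite g0.
by rewrite g0 // mulr0 add0r.
Qed.

Lemma gauge_ge0 n k : grlex_lt 0 n -> (forall j, - iota j <= n j) -> (k <= s)%N ->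
  0 <= gauge k n.
Proof.
by move=> n0 nb /(gauge_ge1_or n0 nb)[|/(_ k (leqnn _)) ->//]; exact: le_trans.
Qed.

Lemma gauge_ge1 n : grlex_lt 0 n -> (forall j, - iota j <= n j) -> 1 <= gauge s n.
Proof.
move=> n0 nb; case: (gauge_ge1_or n0 nb (leqnn s)) => // g0.
suff e : n = 0 by move: n0; rewrite e grlex_lt_irr.
have H j : (j <= s)%N -> gauge j n = gauge j 0 by move/g0; rewrite gauge0.
by have [? /expo_eq] := gauge_eq H; exact.
Qed.

Lemma gaugeE k n : gauge k n =
  (\prod_(0 <= j < k) (1 + iota (inord j))) * total_degree n +
  \sum_(0 <= i < k) (\prod_(i.+1 <= j < k) (1 + iota (inord j))) * n (inord i).
Proof.
elim: k => [|k IH] /=; first by rewrite !big_nil mul1r addr0.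
rewrite IH big_nat_recr //= [\sum_(0 <= _ < k.+1) _]big_nat_recr //=.
rewrite [\prod_(k.+1 <= _ < _) _]big_geq // mul1r addrA.
congr (_ + _); rewrite mulrDr mulrA [_ * \prod_(0 <= _ < _) _]mulrC; congr (_ + _).
rewrite mulr_sumr; apply: eq_big_nat => i /andP[_ ik].
by rewrite big_nat_recr //= mulrA [_ * \prod_(_ <= _ < _) _]mulrC.
Qed.

End Gauge.

(** In the expansion [gaugeE] the degree contributes the full product to every coordinate; a
    coordinate below [s] adds a tail product, which is empty, hence 1, just before the last
    coordinate. These are the three cases of [lambda]. *)
Lemma sum_lambda (K : fieldType) (s : nat) (F : {poly hahn K s.+1}) (n : expo s.+1) :
  \sum_(k < s.+1) lambda F k * n k = gauge (iota0 F) s n.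
Proof.
pose e j := 1 + iota0 F (inord j) : int.
have PE : \prod_(j < s.+1 | (j.+1 < s.+1)%N) (1 + iota0 F j) = \prod_(0 <= j < s) e j.
  rewrite (@big_nat_widen _ _ _ _ _ s.+1) //= big_mkord.
  by apply: eq_big => // j _; rewrite /e inord_val.
have QE (k : 'I_s.+1) :
    \prod_(j < s.+1 | (k < j)%N && (j.+1 < s.+1)%N) (1 + iota0 F j)
    = \prod_(k.+1 <= j < s) e j.
  rewrite (@big_nat_widen _ _ _ _ _ s.+1) //= (@big_nat_widenl _ _ _ _ 0) // big_mkord.
  apply: eq_big => [j|j _]; last by rewrite /e inord_val.
  by rewrite /= andbC.
rewrite gaugeE -/(e _).
have -> : \sum_(0 <= i < s) \prod_(i.+1 <= j < s) (1 + iota0 F (inord j)) * n (inord i) =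
    \sum_(k < s.+1) (if (k < s)%N then \prod_(k.+1 <= j < s) e j else 0) * n k.
  rewrite big_ord_recr /= ltnn mul0r addr0 big_mkord; apply: eq_bigr => i _.
  rewrite ltn_ord; congr (_ * n _); apply: val_inj.
  by rewrite /= inordK // ltnW // ltnS.
rewrite /total_degree mulr_sumr -big_split; apply: eq_bigr => k _ /=.
rewrite -mulrDl; congr (_ * _); rewrite /lambda PE QE addrC.
have := ltn_ord k; rewrite !ltnS => ks.
case: ltnP => [ks2|]; first by rewrite ltnW.
rewrite leq_eqVlt => /orP[/eqP ke|].
  by case: ke => <-; rewrite eqxx leqnn [X in _ = _ + X]big_geq // addrC.
rewrite ltnS => sk; have -> : k = s :> nat by apply/eqP; rewrite eqn_leq ks sk.
by rewrite ltnn addr0 eqSS eqn_leq ltnn.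
Qed.

(** * The multinomial theorem for the powers of [F] *)

Section Multinomial.
Variables (K : fieldType) (r : nat) (F : {poly hahn K r}) (B : set (expo r)).
Hypotheses (hK : [pchar K] =i pred0) (woB : grlex_well_ordered B).
Hypotheses (B0 : B 0) (BD : adds B B B) (FB : supp_poly F B).
Implicit Types (M : Defs.family r) (p : expo r * nat) (n : expo r) (k m : nat).

Definition inc p M : Defs.family r := [fsfun M with p |-> (M p).+1].
Definition dec p M : Defs.family r := [fsfun M with p |-> (M p).-1].

Lemma incE p M q : inc p M q = if q == p then (M p).+1 else M q.
Proof. exact: fsfun_withE. Qed.

Lemma decK p M : M p != 0%N -> inc p (dec p M) = M.
Proof.
move=> Mp; apply/fsfunP => q; rewrite incE !fsfun_withE eqxx.
by case: eqP => [->|_]; [rewrite prednK // lt0n|].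
Qed.

Lemma incK p : cancel (inc p) (dec p).
Proof.
move=> M; apply/fsfunP => q; rewrite fsfun_withE !incE eqxx.
by case: eqP => [->|].
Qed.

(** Both supports are enlarged to one index set [S], where multiplicity 0 contributes [idx]; [c]
    collects the indices other than [p]. *)
Lemma big_inc (T : Type) (idx : T) (op : Monoid.com_law idx)
    (g : expo r * nat -> nat -> T) p M : (forall q, g q 0%N = idx) ->
  exists c, \big[op/idx]_(q <- finsupp M) g q (M q) = op (g p (M p)) c /\
    \big[op/idx]_(q <- finsupp (inc p M)) g q (inc p M q) = op (g p (M p).+1) c.
Proof.
move=> g0; pose S := (p |` finsupp M)%fset.
exists (\big[op/idx]_(q <- (S `\ p)%fset) g q (M q)).
have widen (M' : Defs.family r) : (finsupp M' `<=` S)%fset ->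
    \big[op/idx]_(q <- finsupp M') g q (M' q) =
    op (g p (M' p)) (\big[op/idx]_(q <- (S `\ p)%fset) g q (M' q)).
  move=> sub; rewrite -big_fsetD1 ?fset1U1 //; apply: big_fset_incl => // q _ qM.
  by rewrite fsfun_dflt.
split; first by apply: widen; exact: fsubsetU1.
rewrite widen; last first.
  apply/fsubsetP => q; rewrite mem_finsupp incE in_fset1U mem_finsupp.
  by have [] := eqVneq q p.
rewrite incE eqxx; congr (op _ _); apply: eq_big_seq => q.
by rewrite in_fsetD1 incE => /andP[/negPf->].
Qed.

Lemma fam_size_inc p M : fam_size (inc p M) = (fam_size M).+1.
Proof.
have [c [h1 h2]] := @big_inc _ _ addn (fun _ a => a) p M (fun _ => erefl).
by rewrite /fam_size h1 h2.
Qed.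

Lemma fam_norm_inc p M : fam_norm (inc p M) = (p.2 + fam_norm M)%N.
Proof.
have [c [h1 h2]] := @big_inc _ _ addn (fun q a => q.2 * a)%N p M (fun q => muln0 q.2).
by rewrite /fam_norm h1 h2 mulnS addnA.
Qed.

Lemma fam_weight_inc p M : fam_weight (inc p M) = p.1 + fam_weight M.
Proof.
have [c [h1 h2]] := @big_inc _ _ +%R (fun q a => q.1 *+ a) p M (fun q => mulr0n q.1).
by rewrite /fam_weight h1 h2 mulrS addrA.
Qed.

Lemma fam_fact_inc p M : fam_fact (inc p M) = ((M p).+1 * fam_fact M)%N.
Proof.
have [c [h1 h2]] := @big_inc _ _ muln (fun q a => a`!)%N p M (fun q => erefl).
by rewrite /fam_fact h1 h2 factS mulnA.
Qed.

Lemma fam_monom_inc p M : fam_monom F (inc p M) = acoef F p * fam_monom F M.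
Proof.
have [c [h1 h2]] := @big_inc _ _ *%R (fun q a => acoef F q ^+ a) p M
  (fun q => expr0 (acoef F q)).
by rewrite /fam_monom h1 h2 exprS mulrA.
Qed.

Lemma indexed_byP M : indexed_by F M <-> forall p, M p != 0%N -> acoef F p != 0.
Proof. by split=> MF p; have := MF p; rewrite mem_finsupp. Qed.

Lemma indexed_inc p M : acoef F p != 0 -> indexed_by F M -> indexed_by F (inc p M).
Proof.
move=> Fp /indexed_byP MF; apply/indexed_byP => q; rewrite incE.
by have [->|_] := eqVneq q p; [|exact: MF].
Qed.

Lemma indexed_dec p M : indexed_by F M -> indexed_by F (dec p M).
Proof.
move=> /indexed_byP MF; apply/indexed_byP => q; rewrite fsfun_withE.
by have [->|_] := eqVneq q p; [move=> Mp; apply: MF; case: (M p) Mp|exact: MF].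
Qed.

Lemma acoef_supp p : acoef F p != 0 -> B p.1.
Proof. by move=> Fp; exact: (FB (i := p.2)). Qed.

Lemma fam_weight_in M : indexed_by F M -> B (fam_weight M).
Proof.
move=> MF; rewrite /fam_weight big_seq; elim/big_rec: _ => // p n pM Bn.
apply: BD => //; elim: (M p) => [|a IH]; rewrite ?mulr0n // mulrS.
by apply: BD => //; apply: acoef_supp; exact: MF.
Qed.

(** Here the norm [k] is independent of the size, as the induction on the size requires; [families]
    is the diagonal case, see [familiesS]. *)
Definition fams n k m : set (Defs.family r) :=
  [set M | [/\ indexed_by F M, fam_size M = m, fam_norm M = k & fam_weight M = n]].

Lemma fams_inc n k m p M : acoef F p != 0 ->
  fams n k m M -> fams (p.1 + n) (p.2 + k) m.+1 (inc p M).
Proof.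
move=> Fp [MF <- <- <-]; split; rewrite ?fam_size_inc ?fam_norm_inc ?fam_weight_inc //.
exact: indexed_inc.
Qed.

(** A finite set containing every index used by a family of weight [n] and norm [k], see
    [fams_dec]. *)
Definition slots n k : set (expo r * nat) := (B `&` [set i | B (n - i)]) `*` `I_k.+1.

Lemma slots_finite n k : finite_set (slots n k).
Proof. by apply: finite_setX; [exact: grlex_finite_pairs|exact: finite_II]. Qed.

Lemma fams_dec n k m p M : fams n k m.+1 M -> M p != 0%N ->
  slots n k p /\ fams (n - p.1) (k - p.2) m (dec p M).
Proof.
move=> [MF Mm Mk Mn] Mp; have Fp := (iffLR (indexed_byP M) MF) p Mp.
have dF := indexed_dec (p := p) MF.
move: Mm Mk Mn; rewrite -{1 2 3}(decK Mp) fam_size_inc fam_norm_inc fam_weight_inc.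
move=> [<-] <- <-; rewrite [p.1 + _]addrC addrK addKn; split=> //.
split; last by rewrite /= ltnS leq_addr.
by split; [exact: acoef_supp|rewrite /= addrK; exact: fam_weight_in].
Qed.

Lemma fam_size0 M : fam_size M = 0%N -> M = [fsfun].
Proof.
move=> M0; apply/fsfunP => p; rewrite fsfun0E; case: finsuppP => // pM.
by move: M0; rewrite /fam_size (big_fsetD1 p) //= => /eqP; rewrite addn_eq0 => /andP[/eqP].
Qed.

(** By induction on the size: removing one occurrence of an index leaves finitely many choices of
    index, and of remaining family. *)
Lemma fams_finite n k m : finite_set (fams n k m).
Proof.
elim: m n k => [|m IH] n k.
  by apply: (@sub_finite_set _ _ [set [fsfun]]) => // M [_ /fam_size0].
apply: (@sub_finite_set _ _
  (\bigcup_(p in slots n k) inc p @` fams (n - p.1) (k - p.2) m)); last first.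
  by apply: bigcup_finite => [|p _]; [exact: slots_finite|exact: finite_image].
move=> M Mf; have [p Mp] : exists p, M p != 0%N.
  apply: contrapT => /forallNP M0; case: Mf => _ + _ _.
  by rewrite /fam_size big1_seq // => p _; apply/eqP; move: (M0 p) => /negP; rewrite negbK.
have [Dp dM] := fams_dec Mf Mp; exists p => //; exists (dec p M) => //; exact: decK.
Qed.

Definition multinom_sum n k m : K :=
  \sum_(M \in fams n k m) ((m`!)%:R / (fam_fact M)%:R * fam_monom F M).

Lemma multinom_sum0 n k : multinom_sum n k 0 = (1 : {poly hahn K r})`_k n.
Proof.
pose M0 : Defs.family r := [fsfun].
have sz0 (T : Type) (idx : T) (op : Monoid.com_law idx) (g : expo r * nat -> T) :
    \big[op/idx]_(p <- finsupp M0) g p = idx by rewrite finsupp0 big_seq_fset0.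
have M0n : fam_norm M0 = 0%N by exact: sz0.
have M0w : fam_weight M0 = 0 by exact: sz0.
have M0f : fam_fact M0 = 1%N by exact: sz0.
have M0m : fam_monom F M0 = 1 by exact: sz0.
rewrite /multinom_sum coef1; have [/andP[/eqP k0 /eqP n0]|nkn] := boolP ((k == 0%N) && (n == 0)).
  rewrite k0 n0 (_ : fams _ _ _ = [set M0]).
    by rewrite fsbig_set1 M0f M0m /= eqxx divr1 mulr1.
  apply/seteqP; split=> [M [_ /fam_size0]//|_ ->]; split=> //; last exact: sz0.
  by move=> p; rewrite finsupp0.
rewrite fsbig1 => [|M [_ /fam_size0 -> Mk Mn]]; last first.
  by move: nkn; rewrite -Mk -Mn M0n M0w !eqxx.
by move: nkn; case: eqP => //= _; case: eqP.
Qed.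

Lemma natrS_neq0 m : m.+1%:R != 0 :> K.
Proof. by rewrite (iffLR (pcharf0P K) hK). Qed.

(** Writing the factor m+1 of (m+1)! as the sum of the multiplicities splits each term over the
    indices [p] of its family; dividing M! by the multiplicity of [p] then gives the factorial of
    the family with one [p] removed. *)
Lemma multinom_sumS n k m : multinom_sum n k m.+1 =
  \sum_(p \in slots n k) acoef F p * multinom_sum (n - p.1) (k - p.2) m.
Proof.
pose w p M : K := (M p)%:R * ((m`!)%:R / (fam_fact M)%:R * fam_monom F M).
transitivity (\sum_(M \in fams n k m.+1) \sum_(p \in slots n k) w p M).
  apply: eq_fsbigr => M; rewrite inE => Mf.
  rewrite -mulr_fsuml factS natrM -!mulrA; congr (_ * _).
  have [_ Ms _ _] := Mf.
  rewrite -Ms natr_sum fsbig_seq ?fset_uniq //; apply: fsbig_widen.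
    by move=> p /=; rewrite mem_finsupp => /(fams_dec Mf)[].
  by move=> p [_ /= /negP pM]; rewrite fsfun_dflt.
rewrite exchange_fsbig; [|exact: fams_finite|exact: slots_finite].
apply: eq_fsbigr => p; rewrite inE => -[_ /= pk].
rewrite mulr_fsumr.
have [Fp|Fp] := eqVneq (acoef F p) 0.
  rewrite !fsbig1 // => M; first by rewrite Fp mul0r.
  move=> [/indexed_byP/(_ p) MF _ _ _]; rewrite /w; case: (M p) MF => [|a] MF.
    by rewrite mul0r.
  by move: (MF isT); rewrite Fp eqxx.
(* Families avoiding [p] have weight [w] zero; the others correspond bijectively, through [inc p],
   to families of size [m]. *)
rewrite -(@fsbig_widen _ _ _ _ (fams n k m.+1 `&` [set M | M p != 0%N])); last 2 first.
- by move=> M [].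
- move=> M [Mf nM] /=; rewrite /w; case: (eqVneq (M p) 0%N) => [->|Mp]; first by rewrite mul0r.
  by case: nM.
rewrite (@reindex_fsbig _ _ _ _ _ (inc p) (fams (n - p.1) (k - p.2) m)).
  apply: eq_fsbigr => M _; rewrite /w incE eqxx fam_fact_inc fam_monom_inc natrM invfM.
  move: (M p).+1%:R (natrS_neq0 (M p)) ((fam_fact M)%:R^-1) => x x0 y.
  by field.
split.
- move=> M Mf; split; last by rewrite /= incE eqxx.
  have := fams_inc Fp Mf; rewrite addrC subrK subnKC //.
- by move=> M M' _ _; exact: (can_inj (incK p)).
- move=> M [Mf Mp]; exists (dec p M); last exact: decK.
  by have [] := fams_dec Mf Mp.
Qed.

Lemma coef_exp_multinom n k m : (F ^+ m)`_k n = multinom_sum n k m.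
Proof.
elim: m n k => [|m IH] n k; first by rewrite multinom_sum0.
rewrite multinom_sumS exprS coefM hcoef_sum.
pose A := B `&` [set i | B (n - i)].
transitivity (\sum_(j < k.+1) \sum_(i \in A) F`_j i * multinom_sum (n - i) (k - j) m).
  apply: eq_bigr => j _; rewrite [LHS](@cauchyE _ _ _ _ _ A).
    by apply: eq_fsbigr => i _; rewrite IH.
  move=> i; rewrite mulf_eq0 negb_or => /andP[Fi Gi]; split; first exact: FB Fi.
  exact: supp_polyX B0 BD FB _ _ Gi.
rewrite (@fsbig_ord _ _ _ k.+1
  (fun j => \sum_(i \in A) F`_j i * multinom_sum (n - i) (k - j) m)).
rewrite exchange_fsbig; [|exact: finite_II|exact: grlex_finite_pairs].
by rewrite pair_fsbig //; exact: grlex_finite_pairs.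
Qed.

End Multinomial.

(** * Construction of the solution and its coefficients *)

Section Solution.
Variables (K : fieldType) (s : nat) (F : {poly hahn K s.+1}).
Hypotheses (hK : [pchar K] =i pred0) (hF : strongly_reduced F).
Implicit Types (n : expo s.+1) (m N : nat).

Let iota := iota0 F.
Let height n := gauge iota s n.
Let cone : set (expo s.+1) := [set n | forall k, (k <= s)%N -> 0 <= gauge iota k n].
Let pcone : set (expo s.+1) := cone `&` @grlex_pos s.+1.
(** The filtration by L_(r-1) in which the series of the [term m] converges. *)
Let above N : set (expo s.+1) := [set n | N%:Z <= height n].

Lemma iota_ge0 k : 0 <= iota k.
Proof.
have [_ lb] := iota0P k (let: And3 h _ _ := hF in h).
by have := lb 0 (or_introl erefl); rewrite oppr_le0.
Qed.

Lemma iota_le i j k : acoef F (i, j) != 0 -> - iota k <= i k.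
Proof.
move=> aij; have [_ lb] := iota0P k (let: And3 h _ _ := hF in h).
by apply: lb; right; exists i, j.
Qed.

Lemma F_pos : supp_poly F (@grlex_pos s.+1).
Proof. by case: hF => _ /val_poly_gt0. Qed.

Lemma F_pcone : supp_poly F pcone.
Proof.
move=> j n Fn; have n0 := F_pos Fn; split=> // k ks.
apply: gauge_ge0 => // i; [exact: iota_ge0|exact: (@iota_le n j)].
Qed.

Lemma F_cone : supp_poly F cone.
Proof. by move=> j n /F_pcone[]. Qed.

Lemma F_above : supp_poly F (above 1).
Proof.
move=> j n Fn; apply: (gauge_ge1 iota_ge0 (F_pos Fn)) => i; exact: (@iota_le n j).
Qed.

Lemma cone0 : cone 0.
Proof. by move=> k _; rewrite gauge0. Qed.

Lemma coneD : adds cone cone cone.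
Proof. by move=> n m n0 m0 k ks; rewrite gaugeD addr_ge0 ?n0 ?m0. Qed.

Lemma pconeD : adds pcone pcone pcone.
Proof.
move=> n m [n1 n2] [m1 m2]; split; first exact: coneD.
by apply: grlex_posD => //; exact: grlex_pos_nneg.
Qed.

Lemma above0 : above 0 0.
Proof. by rewrite /above /= /height gauge0. Qed.

Lemma aboveD N N' : adds (above N) (above N') (above (N + N')).
Proof. by move=> n m; rewrite /above /= /height gaugeD PoszD; exact: lerD. Qed.

Lemma aboveD0 N : adds (above N) (above 0) (above N).
Proof. by have := @aboveD N 0; rewrite addn0. Qed.

Lemma aboveS N N' : (N <= N')%N -> above N' `<=` above N.
Proof. by move=> NN n; apply: le_trans; rewrite lez_nat. Qed.

Lemma F_exp_above m : supp_poly (F ^+ m) (above m).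
Proof.
elim: m => [|m IH]; first by rewrite expr0; apply: supp_poly1; exact: above0.
by rewrite exprS; apply: supp_polyM F_above IH; exact: (@aboveD 1 m).
Qed.

Let v m : hahn K s.+1 := hahnC s.+1 (m.+1%:R^-1 : K).

Lemma vP m : m.+1%:R * v m = 1.
Proof.
apply: hahnP => n; rewrite mulr_natl hcoefMn /=.
case: (n == 0); last by rewrite mul0rn.
by rewrite -[LHS]mulr_natr mulVf // natrS_neq0.
Qed.

(** The coefficient of t^m in the solution of Y = t F(Y); [termS] is its closed form. *)
Let term m : hahn K s.+1 := lag0 v F m 'X.

Lemma term0 : term 0 = 0.
Proof. by rewrite /term /lag0 /= hornerX. Qed.

Lemma termS m : term m.+1 = v m * (F ^+ m.+1)`_m.
Proof. exact: lag0X. Qed.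

Lemma term_above m : supp (term m) `<=` above m.
Proof.
case: m => [|m]; first by rewrite term0; exact: supp0.
rewrite termS; apply: (suppM (A := above 0) (B := above m.+1)); last exact: F_exp_above.
  exact: (@aboveD 0 m.+1).
by apply: supp_hahnC; exact: above0.
Qed.

Lemma term_pcone m : supp (term m) `<=` pcone.
Proof.
case: m => [|m]; first by rewrite term0; exact: supp0.
rewrite termS; apply: (suppM (A := [set 0]) (B := pcone)).
- by move=> _ n -> ?; rewrite add0r.
- exact: supp_hahnC.
- by apply: supp_polyXS; [exact: pconeD|exact: F_pcone].
Qed.

Lemma term_eq0 m n : height n < m%:Z -> term m n = 0.
Proof.
move=> nm; apply/eqP; apply: contraTT nm => /term_above.
by rewrite /above /= -leNgt.
Qed.

Let psum N : hahn K s.+1 := \sum_(m < N.+1) term m.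

Lemma psum_widen N N' n : height n <= N%:Z -> (N <= N')%N -> psum N n = psum N' n.
Proof.
move=> nN NN; rewrite /psum !hcoef_sum (big_ord_widen_cond N'.+1 xpredT (fun m => term m n)) //.
rewrite [RHS](bigID (fun m : 'I_N'.+1 => (m < N.+1)%N)) /= [X in _ = _ + X]big1 ?addr0 //.
by move=> m; rewrite -leqNgt => Nm; apply: term_eq0; apply: le_lt_trans nN _; rewrite ltz_nat.
Qed.

Lemma sol_supp : supp (fun n => psum `|height n|%N n) `<=` pcone.
Proof.
move=> n; rewrite /supp /=; apply: (supp_sum (A := pcone)) => m _; exact: term_pcone.
Qed.

Lemma cone_wo : grlex_well_ordered cone.
Proof. exact: gauge_wo. Qed.

Lemma sol_wo : grlex_well_ordered (supp (fun n => psum `|height n|%N n)).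
Proof.
by apply: (grlex_well_orderedS cone_wo) => n /sol_supp[].
Qed.

(** The coefficient at [n] is read off a partial sum past which no term reaches [n], by [term_eq0];
    at negative height every term vanishes. *)
Definition sol : hahn K s.+1 := Hahn sol_wo.

Lemma solE N n : height n <= N%:Z -> sol n = psum N n.
Proof.
move=> nN; have [n0|n0] := leP 0 (height n).
  by apply: psum_widen; rewrite -?lez_nat gez0_abs.
by rewrite /= /psum !hcoef_sum !big1 // => m _; apply: term_eq0; exact: lt_le_trans n0 _.
Qed.

Lemma sol_psum N : supp (sol - psum N) `<=` above N.+1.
Proof.
move=> n; rewrite /supp /=; apply: contraNP => /negP; rewrite -ltNge => nN.
by rewrite -[X in X - _]/(sol n) (@solE N) ?subrr //; lia.
Qed.

(* The truncation [Y] of the solution of [Y = t F(Y)] is a polynomial in [t]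
   whose coefficient of [t^i] lies above [i]; setting [t = 1] in
   [Y = t F(Y)] modulo [t^(N+1)] gives the claim. *)
Lemma psum_fixpoint N : supp (F.[psum N] - psum N) `<=` above N.+1.
Proof.
pose Y : {poly hahn K s.+1} := \poly_(m < N.+1) term m.
pose Z : {poly hahn K s.+1} := \poly_(m < N.+1) term m.+1.
pose W := \sum_(j < size F) F`_j *: Y ^+ j.
pose graded (p : {poly hahn K s.+1}) := forall i, supp p`_i `<=` above i.
have gY j : graded (Y ^+ j).
  elim: j => [|j IH] i.
    by rewrite expr0 coef1; case: eqP => [->|_]; [apply: supp1; exact: above0|exact: supp0].
  rewrite exprS coefM; apply: supp_sum => a _.
  apply: (suppM (A := above a) (B := above (i - a))); last exact: IH.
    by have := @aboveD a (i - a); rewrite subnKC // -ltnS.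
  by rewrite coef_poly; case: ifP => _; [exact: term_above|exact: supp0].
have gW : graded W.
  move=> i; rewrite coef_sum; apply: supp_sum => j _; rewrite coefZ.
  apply: (suppM (A := above 1) (B := above i)); [|exact: F_above|exact: gY].
  move=> a b a1 b1.
  by apply: (@aboveS i (1 + i)) => //; exact: aboveD.
(* Up to degree [N] the truncation is invisible, so multiplicativity of [lag0] computes the powers
   of [Y]. *)
have YE j i : (i <= N)%N -> (Y ^+ j)`_i = lag0 v F i 'X^j.
  elim: j i => [|j IH] i iN; first by rewrite !expr0 coef1 /lag0 lag1; case: eqP; rewrite hornerC.
  rewrite !exprS coefM (lag0M _ vP); apply: eq_bigr => a _.
  have ai : (a <= i)%N by rewrite -ltnS.
  by rewrite coef_poly ltnS (leq_trans ai iN) IH // (leq_trans (leq_subr _ _)).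
have WE i : (i <= N)%N -> W`_i = term i.+1.
  move=> iN; rewrite /term -(lag0_fixpoint F vP) -{2}[F]coefK poly_def lag0_sum coef_sum.
  by apply: eq_bigr => j _; rewrite coefZ YE.
have Y1 : Y.[1] = psum N.
  by rewrite horner_poly; apply: eq_bigr => m _; rewrite expr1n mulr1.
have W1 : W.[1] = F.[psum N].
  rewrite horner_sum horner_coef; apply: eq_bigr => j _.
  by rewrite hornerZ horner_exp Y1.
have Z1 : Z.[1] = psum N + term N.+1.
  transitivity (\sum_(m < N.+2) term m); last by rewrite big_ord_recr.
  rewrite horner_poly [RHS]big_ord_recl term0 add0r; apply: eq_bigr => m _.
  by rewrite expr1n mulr1.
(* [Z] is the series Y divided by t and truncated, so its value at 1 has the extra term of index
   N+1. The difference [W - Z] has no coefficient of degree at most [N]. *)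
have -> : F.[psum N] - psum N = (W - Z).[1] + term N.+1.
  by rewrite hornerD hornerN W1 Z1 opprD addrA addrNK.
apply: suppD; last exact: term_above.
apply: (supp_horner (B := above 0)); first exact: above0.
- exact: aboveD.
- exact: aboveD0.
- move=> i; rewrite coefB coef_poly ltnS; case: leqP => iN.
    by rewrite WE // subrr; exact: supp0.
  by rewrite subr0; apply: subset_trans (gW i) _; exact: aboveS.
- by apply: supp1; exact: above0.
Qed.

(** The defect [sol - F.[sol]] lies above every bound, hence is zero; it is compared with the defect
    of [psum N]. *)
Lemma sol_solution : is_solution F sol.
Proof.
split; last by apply/val_series_gt0 => n /sol_supp[].
have H N : supp (sol - F.[sol]) `<=` above N.+1.
  have sol0 : supp sol `<=` above 0 by move=> n /sol_supp[+ _]; exact.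
  have psum0 : supp (psum N) `<=` above 0.
    by apply: supp_sum => m _; apply: subset_trans (@term_above _) _; exact: aboveS.
  have F0 : supp_poly F (above 0).
    by move=> i; apply: subset_trans (@F_above i) _; exact: aboveS.
  have [g e g0] := horner_diff above0 (@aboveD0 0) (@aboveD0 0) F0 sol0 psum0.
  have -> : sol - F.[sol] = (sol - psum N) - (F.[psum N] - psum N)
      - (F.[sol] - F.[psum N]).
    by rewrite !opprB !addrA; ring.
  rewrite e; apply: suppB; last first.
    by apply: (suppM (@aboveD0 N.+1)) g0; exact: sol_psum.
  by apply: suppB; [exact: sol_psum|exact: psum_fixpoint].
apply/eqP; rewrite -subr_eq0; apply/eqP/hahnP => n; apply/eqP.
rewrite -[_ == _]negbK; apply/negP => /(H `|height n|%N).
by rewrite /above /= leNgt => /negP; apply; lia.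
Qed.

Lemma families0 n : families F n 0 = set0.
Proof. by apply/seteqP; split=> // M []. Qed.

Lemma familiesS n m : families F n m.+1 = fams F n m m.+1.
Proof. by apply/seteqP; split=> M [MF Mm Mk Mn]; split=> //; [case: Mk|rewrite Mk]. Qed.

Lemma families_finite n m : finite_set (families F n m).
Proof.
case: m => [|m]; first by rewrite families0.
by rewrite familiesS; exact: (fams_finite cone_wo cone0 coneD F_cone).
Qed.

(** [height] is additive and at least 1 on each exponent of [F], so every member of the family,
    counted with multiplicity, contributes at least 1. *)
Lemma families_height n m M : families F n m M -> m%:Z <= height n.
Proof.
move=> [MF <- _ <-]; rewrite /height /fam_weight /fam_size gauge_sum.
rewrite (big_morph Posz PoszD (erefl _)) big_seq [leRHS]big_seq; apply: ler_sum => p pM.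
have : above 1 p.1 by apply: (F_above (i := p.2)); exact: MF.
by rewrite /above /= /height gaugeMn -mulr_natr natz; nia.
Qed.

Lemma mu_greatest n : levels F n !=set0 -> is_greatest (levels F n) (mu F n).
Proof.
move=> [m0 L0].
have lb m : levels F n m -> (m <= `|height n|)%N.
  by move=> [M /families_height]; lia.
pose Q := [pred m | `[< levels F n m >]].
have exQ : exists m, Q m by exists m0; apply/asboolP.
have bQ m : Q m -> (m <= `|height n|)%N by move=> /asboolP/lb.
have [m /asboolP Lm mmax] := ex_maxnP exQ bQ.
suff : exists m, is_greatest (levels F n) m by move=> [m' ?]; exact: (xgetPex _ (ex_intro _ m' _)).
by exists m; split=> // m' Lm'; apply: mmax; apply/asboolP.
Qed.

Lemma term_families m n : term m n = m%:R^-1 *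
  \sum_(M \in families F n m) ((m`!)%:R / (fam_fact M)%:R * fam_monom F M).
Proof.
case: m => [|m]; first by rewrite term0 families0 fsbig_set0 mulr0.
rewrite termS hcoefCM familiesS; congr (_ * _).
exact: (coef_exp_multinom hK cone_wo cone0 coneD F_cone).
Qed.

Lemma sol_coef n : sol n = \sum_(1 <= m < (mu F n).+1) m%:R^-1 *
  \sum_(M \in families F n m) ((m`!)%:R / (fam_fact M)%:R * fam_monom F M).
Proof.
(* An order large enough both for the coefficient at [n] to be final and for the sum to be cut at
   [mu F n]. *)
rewrite (@solE (`|height n| + mu F n)%N); last by lia.
under eq_bigr do rewrite -term_families.
rewrite /psum hcoef_sum -(big_mkord xpredT (fun m => term m n)) big_ltn // term0 add0r.
rewrite (@big_cat_nat _ _ _ (mu F n).+1) //=; last by rewrite ltnS leq_addl.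
rewrite [X in _ + X]big_nat_cond [X in _ + X]big1 ?addr0 // => m /andP[/andP[mum _] _].
(* A family of size above [mu F n] would contradict maximality. If no level exists, [mu F n] has its
   default value 0 and all terms vanish likewise. *)
rewrite term_families fsbig1 ?mulr0 // => M FM.
have Lm : levels F n m by exists M.
have [_ /(_ m Lm)] := mu_greatest (ex_intro _ m Lm).
by rewrite leEnat leqNgt mum.
Qed.

End Solution.

Unset Implicit Arguments.
Theorem theorem6p5 (K : fieldType) (hK : [pchar K] =i pred0)
    (r : nat) (hr : (2 <= r)%N)
    (F : {poly hahn K r}) (hF : strongly_reduced F) :
  exists y0 : hahn K r,
  [/\ is_solution F y0,
      forall y : hahn K r, is_solution F y -> y = y0
    & forall n : expo r,
      [/\ forall m : nat, finite_set (families F n m),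
          y0 n = \sum_(1 <= m < (mu F n).+1)
                   m%:R^-1 * \sum_(M \in families F n m)
                     ((m`!)%:R / (fam_fact M)%:R * fam_monom F M)
        & levels F n !=set0 ->
          is_greatest (levels F n) (mu F n) /\
          (mu F n)%:Z <= \sum_(k < r) lambda F k * n k]].
Proof.
case: r hr F hF => [//|s] _ F hF.
exists (sol hF); split.
- exact: sol_solution.
- move=> y yF; apply: (solution_unique (F_pos hF)) yF _; exact: sol_solution.
move=> n; split.
- exact: families_finite.
- exact: sol_coef.
move=> Ln; have mug := mu_greatest hF Ln; split=> //.
(* The bound comes from a family of the greatest size, as its size is at most L_(r-1)(n). *)
have [[M MF] _] := mug; rewrite sum_lambda; exact: families_height MF.
Qed.
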